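(* Let $\mathcal L$ be a real self-adjoint ordinary differential operator on $[0,L]$ with separated or periodic boundary conditions, with Evans function $E$ and weight $W$ as defined in the context, and let $\lambda_0\in\rho(\mathcal L)$ be real with $E(\lambda_0)>0$. Define the sequences $\{\lambda_i^{+}\}$ and $\{\lambda_i^-\}$ by $$\lambda_0^{\pm}=\lambda_0,\qquad \lambda_i^{\pm}=\lambda_{i-1}^{\pm}\pm\frac{E(\lambda_{i-1}^{\pm})}{W(\lambda_{i-1}^{\pm})}\quad(i>0).$$ Let $\lambda^+=\min\{x\in\sigma(\mathcal L): x>\lambda_0\}$ and $\lambda^-=\max\{x\in\sigma(\mathcal L): x<\lambda_0\}$. If $\lambda^+$ exists then $\lim_{i\to\infty}\lambda_i^+=\lambda^+$, and if $\lambda^-$ exists then $\lim_{i\to\infty}\lambda_i^-=\lambda^-$.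
   Context: Setting. Let $L>0$, $n\ge 1$, $\epsilon\in\{1,-1\}$, and let $A_0:[0,L]\to M_{n\times n}(\mathbb R)$ be smooth. Let $e_1,\dots,e_n$ be the standard basis column vectors. The operator $\mathcal L$ on $L_2(0,L)$ is the differential operator given by: $y\in \mathrm{dom}(\mathcal L)$ and $\mathcal L y=g$ ($g\in L_2(0,L)$) if and only if there is an absolutely continuous $u$ on $[0,L]$ with values in $\mathbb C^n$ such that $u_1=y$, $u'=A_0(x)u+\epsilon\, g\,e_n$, and $u$ satisfies the boundary conditions. It is assumed that $u$ is uniquely determined by $y=u_1$ (as for $u=(y,y',\dots,y^{(n-1)})$ or quasi-derivatives), so $\mathcal L$ is well defined. Thus $(\mathcal L-\lambda)y=f$ is equivalent to $u'=A(x,\lambda)u+\epsilon f e_n$ with $A(x,\lambda)=A_0(x)+\epsilon\lambda\, e_ne_1^T$. It is assumed that $\mathcal L$ has compact resolvent. Boundary conditions: either (separated, with $n\ge2$) $B_Lu(0)=0$ and $B_Ru(L)=0$, where for some $0<k<n$ the real matrices $B_L$ ($k\times n$) and $B_R$ ($(n-k)\times n$) satisfy $B_LB_L^T=I_k$, $B_RB_R^T=I_{n-k}$; or (periodic) $u(0)=u(L)$. Self-adjoint means self-adjoint in $L_2(0,L)$ with this domain. The resolvent set $\rho(\mathcal L)$ is the set of $\lambda\in\mathbb C$ for which $(\mathcal L-\lambda)^{-1}$ exists as a bounded operator on $L_2(0,L)$; $\sigma(\mathcal L)=\mathbb C\setminus\rho(\mathcal L)$. For real $\lambda$ let $U(x)=U(x;\lambda)$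 be the fundamental matrix, $U'=A(x,\lambda)U$, $U(0)=I$, and $M=M(\lambda)=U(L;\lambda)$. Separated case: let $N_L$ be a fixed ($\lambda$-independent) real $n\times(n-k)$ matrix whose columns form a basis of the null space of $B_L$; set $E(\lambda)=\det(B_RMN_L)$ and $P(\lambda)=N_L\,\mathrm{adj}(B_RMN_L)\,B_RM$, where $\mathrm{adj}$ denotes the adjugate. Periodic case: set $E(\lambda)=\det(M-I)$ and $P(\lambda)=\mathrm{adj}(M-I)\,M$. In both cases set $$\mathcal G(x,y,\lambda)=\begin{cases}U(x)(E(\lambda)I-P)U^{-1}(y), & y<x,\\ -U(x)PU^{-1}(y), & y>x,\end{cases}$$ $G(x,y,\lambda)=[\mathcal G(x,y,\lambda)]_{1n}$, and $W(\lambda)=\left(\int_0^L\int_0^LG(x,y,\lambda)^2\,dy\,dx\right)^{1/2}$. *)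

(* Defs.v *)
From HB Require Import structures.
From mathcomp Require Import all_boot all_order all_algebra.
From mathcomp Require Import all_classical all_reals all_analysis.
From mathcomp Require Import complex.

Set Implicit Arguments.
Unset Strict Implicit.
Unset Printing Implicit Defensive.
Import Order.TTheory GRing.Theory Num.Theory.
Import numFieldNormedType.Exports.

Local Open Scope classical_set_scope.
Local Open Scope ring_scope.
Local Open Scope complex_scope.

(* C^oo([a, b]): [D k] is the k-th derivative, continuous up to the endpoints. *)
Definition smooth_on (R : realType) (a b : R) (f : R -> R) : Prop :=
  exists D : nat -> R -> R,
    (forall x, x \in `[a, b] -> D 0%N x = f x) /\
    forall k, {within `[a, b], continuous (D k)} /\
      forall x, x \in `]a, b[ -> is_derive x (1 : R) (D k) (D k.+1 x).

Definition abs_continuous (R : realType) (a b : R) (f : R -> R) : Prop :=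
  forall e : R, 0 < e -> exists2 d : R, 0 < d &
    forall (m : nat) (s t : 'I_m -> R),
      (forall i, a <= s i /\ s i <= t i /\ t i <= b) ->
      trivIset [set: 'I_m] (fun i => `]s i, t i[%classic) ->
      \sum_(i < m) (t i - s i) < d ->
      \sum_(i < m) `|f (t i) - f (s i)| < e.

Section ComplexL2.
Variables (R : realType) (L : R).
Local Notation C := R[i].
Local Notation mu := (@lebesgue_measure R).

Definition is_cderive (x : R) (f : R -> C) (df : C) : Prop :=
  is_derive x (1 : R) (fun t => complex.Re (f t)) (complex.Re df) /\
  is_derive x (1 : R) (fun t => complex.Im (f t)) (complex.Im df).

Definition cabs_continuous (f : R -> C) : Prop :=
  abs_continuous 0 L (fun t => complex.Re (f t)) /\
  abs_continuous 0 L (fun t => complex.Im (f t)).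

(* Elements of L_2(0, L) are represented by functions, of which only the
   restriction to [0, L], up to null sets, is relevant. *)
Definition L2 (f : R -> C) : Prop :=
  [/\ measurable_fun `[0, L] (fun t => complex.Re (f t)),
      measurable_fun `[0, L] (fun t => complex.Im (f t)) &
      mu.-integrable `[0, L] (fun t => (Normc.normc (f t) ^+ 2)%:E)].

Definition ae_equal (f g : R -> C) : Prop :=
  {ae mu, forall x, x \in `[0, L] -> f x = g x}.

Definition cintegral (f : R -> C) : C :=
  (\int[mu]_(x in `[0, L]) complex.Re (f x)) +i*
  (\int[mu]_(x in `[0, L]) complex.Im (f x)).

Definition L2inner (f g : R -> C) : C := cintegral (fun x => f x * (g x)^*).

Definition L2norm (f : R -> C) : R :=
  Num.sqrt (\int[mu]_(x in `[0, L]) (Normc.normc (f x) ^+ 2)).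

(* An unbounded operator on L_2(0, L) is given by its graph: [T y g] means
   that y is in the domain of T and T y = g. *)
Implicit Type T : (R -> C) -> (R -> C) -> Prop.

(* (T - z) y = f *)
Definition shift_graph T (z : C) (y f : R -> C) : Prop :=
  T y (fun x => f x + z * y x).

Definition resolvent_set T (z : C) : Prop :=
  [/\ forall f, L2 f -> exists y, shift_graph T z y f,
      forall f y1 y2, L2 f -> shift_graph T z y1 f -> shift_graph T z y2 f ->
        ae_equal y1 y2 &
      exists K : R, forall f y, L2 f -> shift_graph T z y f ->
        L2norm y <= K * L2norm f].

Definition spectrum T (z : C) : Prop := ~ resolvent_set T z.

Definition compact_resolvent T : Prop :=
  exists2 z, resolvent_set T z &
    forall (f y : nat -> R -> C) (K : R),
      (forall i, L2 (f i)) -> (forall i, L2norm (f i) <= K) ->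
      (forall i, shift_graph T z (y i) (f i)) ->
      exists (phi : nat -> nat) (v : R -> C),
        [/\ {homo phi : i j / (i < j)%N}, L2 v &
            L2norm (fun x => y (phi i) x - v x) @[i --> \oo] --> (0 : R)].

Definition densely_defined T : Prop :=
  forall f, L2 f -> forall e : R, 0 < e ->
    exists y g, T y g /\ L2norm (fun x => f x - y x) < e.

Definition adjoint_graph T (z h : R -> C) : Prop :=
  [/\ L2 z, L2 h & forall y g, T y g -> L2inner g z = L2inner y h].

Definition self_adjoint T : Prop :=
  densely_defined T /\ forall z h, T z h <-> adjoint_graph T z h.

End ComplexL2.

(* [Separated k BL BR NL] carries, besides the matrices of the boundary
   conditions, the chosen basis NL of the null space of BL. *)
Inductive boundary (R : realType) (n : nat) : Type :=
| Separated (k : nat) of 'M[R]_(k, n) & 'M[R]_(n - k, n) & 'M[R]_(n, n - k)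
| Periodic.
Arguments Periodic {R n}.

Definition boundary_wf (R : realType) (n : nat) (bc : boundary R n) : Prop :=
  match bc with
  | Separated k BL BR NL =>
      [/\ (0 < k < n)%N, BL *m BL^T = 1%:M, BR *m BR^T = 1%:M,
          (forall v : 'cV[R]_n,
             BL *m v = 0 <-> exists c : 'cV[R]_(n - k), v = NL *m c) &
          (forall c : 'cV[R]_(n - k), NL *m c = 0 -> c = 0)]
  | Periodic => True
  end.

Definition satisfies_bc (R : realType) (n : nat) (L : R) (bc : boundary R n)
    (u : R -> 'cV[R[i]]_n) : Prop :=
  match bc with
  | Separated k BL BR _ =>
      map_mx (real_complex R) BL *m u 0 = 0 /\
      map_mx (real_complex R) BR *m u L = 0
  | Periodic => u 0 = u L
  end.

Section Operator.
Variables (R : realType) (n : nat) (L eps : R) (A0 : R -> 'M[R]_n.+1).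
Variable bc : boundary R n.+1.
Local Notation C := R[i].
Local Notation mu := (@lebesgue_measure R).

(* u is absolutely continuous, satisfies the boundary conditions and
   u' = A_0 u + eps g e_n a.e. *)
Definition bvp_solution (u : R -> 'cV[C]_n.+1) (g : R -> C) : Prop :=
  [/\ forall i, cabs_continuous L (fun x => u x i 0),
      {ae mu, forall x, x \in `]0, L[ -> forall i,
         is_cderive x (fun t => u t i 0)
           ((map_mx (real_complex R) (A0 x) *m u x
             + (eps%:C * g x) *: delta_mx ord_max 0) i 0)} &
      satisfies_bc L bc u].

Definition ode_operator (y g : R -> C) : Prop :=
  [/\ L2 L y, L2 L g &
      exists2 u, bvp_solution u g & ae_equal L y (fun x => u x ord0 0)].

Definition determined_by_first : Prop :=
  forall u v g h, L2 L g -> L2 L h ->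
    bvp_solution u g -> bvp_solution v h ->
    (forall x, x \in `[0, L] -> u x ord0 0 = v x ord0 0) ->
    forall x, x \in `[0, L] -> u x = v x.

Definition coef_mx (x lam : R) : 'M[R]_n.+1 :=
  A0 x + (eps * lam) *: ((delta_mx ord_max 0 : 'cV[R]_n.+1)
                         *m (delta_mx ord0 0 : 'cV[R]_n.+1)^T).

(* [U lam x] stands for U(x; lam); by continuity the one-sided derivatives at
   0 and L satisfy the equation as well. *)
Definition fundamental_mx (U : R -> R -> 'M[R]_n.+1) : Prop :=
  forall lam,
    [/\ U lam 0 = 1%:M,
        forall i j, {within `[0, L], continuous (fun x => U lam x i j)} &
        forall x, x \in `]0, L[ -> forall i j,
          is_derive x (1 : R) (fun t => U lam t i j)
            ((coef_mx x lam *m U lam x) i j)].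

Variable U : R -> R -> 'M[R]_n.+1.

Definition evans (lam : R) : R :=
  let M := U lam L in
  match bc with
  | Separated k BL BR NL => \det (BR *m M *m NL)
  | Periodic => \det (M - 1%:M)
  end.

Definition evans_P (lam : R) : 'M[R]_n.+1 :=
  let M := U lam L in
  match bc with
  | Separated k BL BR NL => NL *m \adj (BR *m M *m NL) *m (BR *m M)
  | Periodic => \adj (M - 1%:M) *m M
  end.

(* The value on the diagonal x = y is immaterial. *)
Definition green_mx (x y lam : R) : 'M[R]_n.+1 :=
  if y < x
  then U lam x *m ((evans lam)%:M - evans_P lam) *m invmx (U lam y)
  else - (U lam x *m evans_P lam *m invmx (U lam y)).

Definition green (x y lam : R) : R := green_mx x y lam ord0 ord_max.

Definition weight (lam : R) : R :=
  Num.sqrt (\int[mu]_(x in `[0, L])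
              (\int[mu]_(y in `[0, L]) (green x y lam ^+ 2))).

(* s = 1 and s = -1 give the increasing and the decreasing iteration. *)
Fixpoint evans_seq (s lam0 : R) (i : nat) : R :=
  if i is j.+1
  then evans_seq s lam0 j
       + s * (evans (evans_seq s lam0 j) / weight (evans_seq s lam0 j))
  else lam0.

End Operator.

(* Main.v *)
Require Import Defs.
From mathcomp Require Import all_boot all_order all_algebra.
From mathcomp Require Import all_classical all_reals all_analysis.
From mathcomp Require Import measurable_realfun complex.
From mathcomp Require Import ring lra.
Set Implicit Arguments.
Unset Strict Implicit.
Unset Printing Implicit Defensive.
Import Order.TTheory GRing.Theory Num.Theory.
Import numFieldNormedType.Exports.
Local Open Scope classical_set_scope.
Local Open Scope ring_scope.

(** The key is an inequality between the distance from a real regular point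
    [lam] to an eigenvalue and the quotient E/W.  When E(lam) is nonzero,
    variation of constants solves (L - lam) y = f by the formula
    E(lam) y(x) = int G(x, s, lam) eps f(s) ds ([green_formula]), so by
    Cauchy-Schwarz E(lam)^2 |y|^2 <= W(lam)^2 |f|^2 ([solution_bound]): W/|E|
    is the Hilbert-Schmidt norm of the resolvent.  If [lam1] is a zero of E,
    some nonzero vector c makes u = U(.; lam1) c satisfy the boundary
    conditions, which gives an eigenfunction y; since
    (L - lam) y = (lam1 - lam) y, it follows that
    |E(lam)| / W(lam) <= |lam1 - lam| ([evans_weight_bound]).

    On the real line the spectrum is the zero set of E.  A zero of E gives an
    eigenfunction, so it is not regular ([resolvent_evans_neq0]).  Conversely,
    if E(lam) is nonzero ([evans_neq0_resolvent]), the formula above solves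
    (L - lam) y = f for every f in L_2; self-adjointness makes the solution
    unique, because the difference of two solutions is orthogonal to the range
    of L - lam, that is, to every f; and [solution_bound] makes the inverse
    bounded.

    Hence E is positive from lambda_0 up to the next point lambda^+ of the
    spectrum, by continuity, and the sequence increases and never passes
    lambda^+.  If its limit l were smaller than lambda^+, the steps E/W would
    not tend to 0, as E(l) > 0 and W is bounded near l: a contradiction
    ([quotient_iteration_cvg]).  The decreasing sequence is treated in the same
    way.

    The dependence of U on x and lambda is controlled by Gronwall's
    inequality for |u|^2 ([gronwall], [linear_system_bound]); it gives the
    invertibility of U(x), bounds for U and its inverse that are locally
    uniform in lambda, and the Lipschitz dependence of U on lambda, hence the
    continuity of E and P and the local boundedness of W. *)

(** * Limits of matrix operations *)

Section matrix_limits.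
Context {R : realType} {T : Type} {F : set_system T} {FF : Filter F}.

Lemma cvg_sumr (I : Type) (r : seq I) (P : pred I) (f : I -> T -> R) (a : I -> R) :
  (forall i, P i -> f i x @[x --> F] --> a i) ->
  \sum_(i <- r | P i) f i x @[x --> F] --> \sum_(i <- r | P i) a i.
Proof. by move=> fa; apply: cvg_big => //; exact: add_continuous. Qed.

Lemma cvg_prodr (I : Type) (r : seq I) (P : pred I) (f : I -> T -> R) (a : I -> R) :
  (forall i, P i -> f i x @[x --> F] --> a i) ->
  \prod_(i <- r | P i) f i x @[x --> F] --> \prod_(i <- r | P i) a i.
Proof. by move=> fa; apply: cvg_big => //; exact: mul_continuous. Qed.

Lemma cvg_det n (A : T -> 'M[R]_n) (a : 'M[R]_n) :
  (forall i j, A x i j @[x --> F] --> a i j) ->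
  \det (A x) @[x --> F] --> \det a.
Proof.
move=> Aa; apply: cvg_sumr => s _; apply: cvgM; first exact: cvg_cst.
by apply: cvg_prodr.
Qed.

Lemma cvg_adj n (A : T -> 'M[R]_n) (a : 'M[R]_n) :
  (forall i j, A x i j @[x --> F] --> a i j) ->
  forall i j, (\adj (A x)) i j @[x --> F] --> (\adj a) i j.
Proof.
move=> Aa i j; rewrite !mxE; under eq_cvg do rewrite !mxE.
apply: cvgM; first exact: cvg_cst.
by apply: cvg_det => k l; rewrite !mxE; under eq_cvg do rewrite !mxE; exact: Aa.
Qed.

Lemma cvg_mulmx m n p (A : T -> 'M[R]_(m, n)) (a : 'M[R]_(m, n))
    (B : T -> 'M[R]_(n, p)) (b : 'M[R]_(n, p)) :
  (forall i j, A x i j @[x --> F] --> a i j) ->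
  (forall i j, B x i j @[x --> F] --> b i j) ->
  forall i j, (A x *m B x) i j @[x --> F] --> (a *m b) i j.
Proof.
move=> Aa Bb i j; rewrite !mxE; under eq_cvg do rewrite !mxE.
by apply: cvg_sumr => k _; exact: cvgM.
Qed.

Lemma cvg_invmx n (A : T -> 'M[R]_n) (a : 'M[R]_n) :
  (\forall x \near F, A x \in unitmx) -> a \in unitmx ->
  (forall i j, A x i j @[x --> F] --> a i j) ->
  forall i j, invmx (A x) i j @[x --> F] --> invmx a i j.
Proof.
move=> Au au Aa i j.
have : (\det (A x))^-1 * (\adj (A x)) i j @[x --> F] --> invmx a i j.
  rewrite /invmx au mxE; apply: cvgM; last exact: cvg_adj.
  apply: cvgV; first by move: au; rewrite unitmxE unitfE.
  exact: cvg_det.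
apply: cvg_trans; apply: near_eq_cvg.
by apply: filterS Au => x Ax; rewrite /invmx Ax !mxE.
Qed.

End matrix_limits.

(** * Gronwall's inequality *)

Section gronwall.
Context {R : realType}.
Implicit Types (f g phi : R -> R) (x : R).

Lemma is_derive_mulE f g x df dg :
  is_derive x (1 : R) f df -> is_derive x (1 : R) g dg ->
  is_derive x (1 : R) (fun t => f t * g t) (df * g x + f x * dg).
Proof.
move=> fdf gdg; refine (is_derive_eq (is_deriveM fdf gdg) _).
by rewrite addrC; congr (_ + _); rewrite /GRing.scale/= mulrC.
Qed.

Lemma is_derive_addE f g x df dg :
  is_derive x (1 : R) f df -> is_derive x (1 : R) g dg ->
  is_derive x (1 : R) (fun t => f t + g t) (df + dg).
Proof. exact: is_deriveD. Qed.

Lemma is_derive_sumE n (h : 'I_n -> R -> R) x (dh : 'I_n -> R) :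
  (forall i, is_derive x (1 : R) (h i) (dh i)) ->
  is_derive x (1 : R) (fun t => \sum_(i < n) h i t) (\sum_(i < n) dh i).
Proof.
move=> hdh; rewrite [X in is_derive _ _ X](_ : _ = \sum_(i < n) h i).
  exact: is_derive_sum.
by apply/funext => t; rewrite fct_sumE.
Qed.

Lemma is_derive_lin c x : is_derive x (1 : R) (fun t => c * t) c.
Proof.
refine (is_derive_eq (is_deriveZ c (is_derive_id x (1 : R))) _).
by rewrite /GRing.scale/= mulr1.
Qed.

Lemma is_derive_exp_lin c x :
  is_derive x (1 : R) (fun t => expR (c * t)) (c * expR (c * x)).
Proof.
refine (is_derive_eq (is_derive1_comp (is_derive_expR (c * x)) (is_derive_lin c x)) _).
exact: mulrC.
Qed.

(** Both bounds come from the monotonicity of exp(-C x) phi(x) and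
    exp(C x) phi(x), each corrected by a linear term. *)
Lemma gronwall (L C D : R) phi dphi :
  0 <= C -> 0 <= D ->
  {within `[0, L], continuous phi} ->
  (forall x, x \in `[0, L] -> 0 <= phi x) ->
  (forall x, x \in `]0, L[ -> is_derive x (1 : R) phi (dphi x)) ->
  (forall x, x \in `]0, L[ -> `|dphi x| <= C * phi x + D) ->
  forall t, t \in `[0, L] ->
    phi t <= expR (C * L) * (phi 0 + D * L) /\
    phi 0 <= expR (C * L) * (phi t + D * L).
Proof.
move=> C0 D0 cphi phi0 dphiP dphiC t tL.
have L0 : 0 <= L by move: tL; rewrite in_itv/=; lra.
have in0 : (0 : R) \in `[0, L] by rewrite in_itv/= lexx.
have tP : 0 <= t <= L by move: tL; rewrite in_itv.
have cE c : {within `[0, L], continuous (fun x => expR (c * x))}.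
  apply: continuous_subspaceT => x; apply: continuous_comp.
    exact: mulrl_continuous.
  exact: continuous_expR.
have cl c : {within `[0, L], continuous (fun x => c * x)}.
  by apply: continuous_subspaceT => x; exact: mulrl_continuous.
split.
- pose psi x := expR (- C * x) * phi x + (- D) * x.
  have dpsi x : x \in `]0, L[ -> is_derive x (1 : R) psi
      (- C * expR (- C * x) * phi x + expR (- C * x) * dphi x + - D).
    move=> xL; apply: is_derive_addE; last exact: is_derive_lin.
    by apply: is_derive_mulE; [exact: is_derive_exp_lin|exact: dphiP].
  have : psi t <= psi 0.
    apply: (@ler0_derive1_nincr _ psi 0 L) => //; try lra.
    + by move=> x /dpsi [].
    + move=> x xL; have dx := dpsi _ xL; rewrite derive1E derive_val.
      have := dphiC _ xL; rewrite ler_norml => /andP[_ h].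
      have e1 : expR (- C * x) <= 1.
        rewrite -expR0 ler_expR; move: xL; rewrite in_itv/= => /andP[x0 _].
        by rewrite mulNr oppr_le0 mulr_ge0// ltW.
      have e0 := expR_gt0 (- C * x).
      nra.
    + move=> x; apply: cvgD; last exact: cl.
      by apply: cvgM; [exact: cE|exact: cphi].
  rewrite /psi !mulr0 expR0 mul1r addr0 => h.
  have e0 := expR_gt0 (C * t).
  have : expR (C * t) * (expR (- C * t) * phi t) <= expR (C * t) * (phi 0 + D * t).
    by rewrite ler_pM2l//; lra.
  rewrite mulrA -expRD mulNr subrr expR0 mul1r => /le_trans; apply.
  have p0 := phi0 _ in0.
  apply: ler_pM; rewrite ?expR_ge0 ?ler_expR//; nra.
- pose psi x := expR (C * x) * phi x + (D * expR (C * L)) * x.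
  have dpsi x : x \in `]0, L[ -> is_derive x (1 : R) psi
      (C * expR (C * x) * phi x + expR (C * x) * dphi x + D * expR (C * L)).
    move=> xL; apply: is_derive_addE; last exact: is_derive_lin.
    by apply: is_derive_mulE; [exact: is_derive_exp_lin|exact: dphiP].
  have : psi 0 <= psi t.
    apply: (@ger0_derive1_ndecr _ psi 0 L) => //; try lra.
    + by move=> x /dpsi [].
    + move=> x xL; have dx := dpsi _ xL; rewrite derive1E derive_val.
      have := dphiC _ xL; rewrite ler_norml => /andP[h _].
      have e1 : expR (C * x) <= expR (C * L).
        rewrite ler_expR; move: xL; rewrite in_itv/= => /andP[x0 xl].
        by rewrite ler_wpM2l// ltW.
      have e0 := expR_gt0 (C * x).
      have : 0 <= expR (C * x) * (C * phi x + D + dphi x) by rewrite mulr_ge0; lra.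
      nra.
    + move=> x; apply: cvgD; last exact: cl.
      by apply: cvgM; [exact: cE|exact: cphi].
  rewrite /psi !mulr0 expR0 mul1r addr0 => /le_trans; apply.
  have e0 := expR_gt0 (C * L).
  have p0 := phi0 _ tL.
  have : expR (C * t) * phi t <= expR (C * L) * phi t.
    by rewrite ler_wpM2r// ler_expR; nra.
  have : D * expR (C * L) * t <= D * expR (C * L) * L.
    by rewrite ler_wpM2l ?mulr_ge0//; lra.
  lra.
Qed.

End gronwall.

(** * Linear differential systems *)

Section linear_system.
Context {R : realType}.

Lemma sqr_le_norm_le (x d C : R) :
  0 <= C -> x ^+ 2 <= C * d ^+ 2 -> `|x| <= (C + 1) * `|d|.
Proof.
move=> C0 h; rewrite -ler_sqr ?nnegrE ?mulr_ge0//; last lra.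
rewrite real_normK ?num_real// exprMn real_normK ?num_real//.
by apply: le_trans h _; apply: ler_wpM2r; [exact: sqr_ge0|nra].
Qed.

(** Gronwall's inequality for the squared norm of a solution of w' = B w + r:
    forward from 0 to t, and backward. *)
Lemma linear_system_bound n (L K rho : R) (B : R -> 'M[R]_n)
    (w : R -> 'cV[R]_n) (r : R -> 'cV[R]_n) :
  0 <= K ->
  (forall x, x \in `]0, L[ -> forall i j, `|B x i j| <= K) ->
  (forall x, x \in `]0, L[ -> forall i, `|r x i 0| <= rho) ->
  (forall i, {within `[0, L], continuous (fun x => w x i 0)}) ->
  (forall x, x \in `]0, L[ -> forall i,
     is_derive x (1 : R) (fun t => w t i 0) ((B x *m w x + r x) i 0)) ->
  let phi x := \sum_i w x i 0 ^+ 2 in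
  let G := expR (((2 * K) * n%:R + 1) * L) in
  forall t, t \in `[0, L] ->
    phi t <= G * (phi 0 + (n%:R * rho ^+ 2) * L) /\
    phi 0 <= G * (phi t + (n%:R * rho ^+ 2) * L).
Proof.
move=> K0 BK rrho cw dw phi G t tL.
pose dphi x := \sum_i ((B x *m w x + r x) i 0 * w x i 0 +
                       w x i 0 * (B x *m w x + r x) i 0).
have n0 : 0 <= n%:R :> R by exact: ler0n.
apply: (gronwall (dphi := dphi)) tL.
- by apply: addr_ge0 => //; apply: mulr_ge0 => //; lra.
- by apply: mulr_ge0 => //; exact: sqr_ge0.
- move=> x; rewrite /phi; apply: cvg_sumr => i _.
  rewrite (_ : (fun x : R => w x i 0 ^+ 2) = (fun x : R => w x i 0 * w x i 0))//.
  by apply: cvgM; exact: cw.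
- by move=> x _; apply: sumr_ge0 => i _; exact: sqr_ge0.
- move=> x xL; apply: is_derive_sumE => i.
  by apply: is_derive_mulE; exact: dw.
- move=> x xL.
  (* 2 |w_i b_ij w_j| <= K (w_i^2 + w_j^2) and 2 |w_i r_i| <= w_i^2 + rho^2 *)
  have h i : `|(B x *m w x + r x) i 0 * w x i 0 + w x i 0 * (B x *m w x + r x) i 0|
      <= \sum_j K * (w x i 0 ^+ 2 + w x j 0 ^+ 2) + (w x i 0 ^+ 2 + rho ^+ 2).
    rewrite !mxE mulrC -mulr2n -mulrnAr.
    rewrite mulrnDl mulrDr; apply: le_trans (ler_normD _ _) _; apply: lerD.
      rewrite -sumrMnl mulr_sumr; apply: le_trans (ler_norm_sum _ _ _) _.
      apply: ler_sum => j _; rewrite mulrnAr normrMn !normrM.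
      have := BK _ xL i j; set b := `|B x i j|; rewrite -[w x i 0 ^+ 2]real_normK ?num_real//.
      rewrite -[w x j 0 ^+ 2]real_normK ?num_real//.
      set a := `|w x i 0|; set c := `|w x j 0| => bK.
      have ac : 0 <= a * c by rewrite mulr_ge0 ?normr_ge0.
      have b0 : 0 <= b by exact: normr_ge0.
      have := sqr_ge0 (a - c); rewrite mulr2n => ac2.
      have : b * (a * c) <= K * (a * c) by rewrite ler_wpM2r.
      have : 0 <= K * (a - c) ^+ 2 by rewrite mulr_ge0.
      nra.
    rewrite mulrnAr normrMn !normrM.
    have := rrho _ xL i; rewrite -[w x i 0 ^+ 2]real_normK ?num_real//.
    set b := `|r x i 0|; set a := `|w x i 0| => br.
    have b0 : 0 <= b by exact: normr_ge0.
    have a0 : 0 <= a by exact: normr_ge0.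
    have := sqr_ge0 (a - rho); rewrite mulr2n => ac2.
    nra.
  apply: le_trans (ler_norm_sum _ _ _) _.
  apply: le_trans (ler_sum _ (fun i _ => h i)) _.
  rewrite big_split/= big_split/= sumr_const card_ord.
  rewrite (_ : \sum_i \sum_j _ = (2 * K * n%:R) * phi x); last first.
    under eq_bigr do rewrite -mulr_sumr big_split/= sumr_const card_ord -/(phi x).
    rewrite -mulr_sumr big_split/= sumr_const card_ord.
    rewrite sumrMnl -/(phi x) -mulr_natr; ring.
  rewrite -/(phi x) -[rho ^+ 2 *+ n]mulr_natl; lra.
Qed.

Lemma le_sum_sqr m (c : 'cV[R]_m) i : c i 0 ^+ 2 <= \sum_j c j 0 ^+ 2.
Proof.
by rewrite (bigD1 i)//= lerDl; apply: sumr_ge0 => j _; exact: sqr_ge0.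
Qed.

Lemma sum_sqr_delta m (i : 'I_m) :
  \sum_j (delta_mx i 0 : 'cV[R]_m) j 0 ^+ 2 = 1.
Proof.
rewrite (bigD1 i)//= mxE !eqxx expr1n big1 ?addr0// => j ji.
by rewrite mxE (negbTE ji) expr0n.
Qed.

Lemma mxE_delta m p (A : 'M[R]_(m, p)) i j :
  A i j = (A *m (delta_mx j 0 : 'cV[R]_p)) i 0.
Proof. by rewrite -colE mxE. Qed.

End linear_system.

(** * The fundamental matrix *)

Lemma continuous_itv_bounded (R : realType) (a b : R) (f : R -> R) :
  {within `[a, b], continuous f} ->
  exists K, forall x, x \in `[a, b] -> `|f x| <= K.
Proof.
move=> cf; have [ab|ba] := leP a b; last first.
  by exists 0 => x; rewrite in_itv/=; lra.
have cn : {within `[a, b], continuous (fun x => `|f x|)}.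
  by move=> x; apply: cvg_norm; exact: cf.
by have [c _ hc] := EVT_max ab cn; exists `|f c|.
Qed.

Lemma finite_common_bound (R : realType) (I : finType) (T : Type) (D : T -> Prop)
    (f : I -> T -> R) :
  (forall i, exists K, forall x, D x -> `|f i x| <= K) ->
  exists2 K : R, 0 <= K & forall i x, D x -> `|f i x| <= K.
Proof.
move=> /choice[K KP]; exists (\sum_i `|K i|); first exact: sumr_ge0.
move=> i x /KP h; apply: (le_trans (h i)); rewrite (bigD1 i)//=.
by apply: (le_trans (ler_norm _)); rewrite lerDl; exact: sumr_ge0.
Qed.

Lemma smooth_on_bounded (R : realType) (a b : R) (f : R -> R) :
  smooth_on a b f -> exists K, forall x, x \in `[a, b] -> `|f x| <= K.
Proof.
move=> [D [D0 DP]]; have [K KP] := continuous_itv_bounded (DP 0%N).1.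
by exists K => x xab; rewrite -D0//; exact: KP.
Qed.

Section fundamental.
Context {R : realType} (n : nat) (L eps : R).
Variables (A0 : R -> 'M[R]_n.+1) (U : R -> R -> 'M[R]_n.+1).
Hypotheses (L0 : 0 < L) (eps1 : eps = 1 \/ eps = -1).
Hypothesis A0_smooth : forall i j, smooth_on 0 L (fun x => A0 x i j).
Hypothesis UP : fundamental_mx L eps A0 U.

Let N : R := n.+1%:R.
Let N_gt0 : 0 < N. Proof. exact: ltr0Sn. Qed.

Lemma zero_in_itv : (0 : R) \in `[0, L].
Proof. by rewrite in_itv/= lexx ltW. Qed.

Lemma right_in_itv : L \in `[0, L].
Proof. by rewrite in_itv/= lexx andbT ltW. Qed.

Lemma open_in_itv x : x \in `]0, L[ -> x \in `[0, L].
Proof. by rewrite !in_itv/= => /andP[/ltW-> /ltW->]. Qed.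

Lemma norm_eps : `|eps| = 1.
Proof. by case: eps1 => ->; rewrite ?normrN normr1. Qed.

Lemma coef_mxE x lam i j : coef_mx eps A0 x lam i j =
  A0 x i j + (eps * lam) * ((i == ord_max)%:R * (j == ord0)%:R).
Proof.
rewrite !mxE big_ord1 !mxE; congr (_ + _ * _).
by rewrite eqxx !andbT.
Qed.

Lemma coef_mx_mulmx x lam (w : 'cV[R]_n.+1) i : (coef_mx eps A0 x lam *m w) i 0 =
  (A0 x *m w + (eps * (lam * w ord0 0)) *: (delta_mx ord_max 0 : 'cV[R]_n.+1)) i 0.
Proof.
rewrite [LHS]mxE; under eq_bigr do rewrite coef_mxE mulrDl.
rewrite big_split/= [X in _ + X = _](bigD1 ord0)//=.
rewrite [X in _ + (_ + X) = _]big1 => [|j /negbTE ->]; last first.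
  by rewrite !mulr0 mul0r.
rewrite !mxE !eqxx andbT; ring.
Qed.

Lemma coef_mx_bound : exists2 K : R, 0 <= K &
  forall lam (x : R) i j, x \in `[0, L] -> `|coef_mx eps A0 x lam i j| <= K + `|lam|.
Proof.
have [K K0 KP] := @finite_common_bound R ('I_n.+1 * 'I_n.+1)%type R
  (fun x => x \in `[0, L]) (fun p x => A0 x p.1 p.2)
  (fun p => smooth_on_bounded (A0_smooth p.1 p.2)).
exists K => // lam x i j xL; rewrite coef_mxE.
apply: le_trans (ler_normD _ _) _; apply: lerD; first exact: (KP (i, j)).
rewrite !normrM norm_eps mul1r !normr_nat.
by case: eqP; case: eqP; rewrite ?(mulr0, mulr1, mul0r).
Qed.

Lemma fundamental_mx_mulmx p (lam : R) (c : 'M[R]_(n.+1, p)) x i j :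
  x \in `]0, L[ ->
  is_derive x (1 : R) (fun t => (U lam t *m c) i j)
    ((coef_mx eps A0 x lam *m (U lam x *m c)) i j).
Proof.
move=> xL; have [_ _ dU] := UP lam.
rewrite mulmxA mxE; under eq_fun do rewrite mxE.
apply: is_derive_sumE => k; have := dU _ xL i k.
set d := (_ *m _) i k => h.
have h0 : is_derive x (1 : R) (fun=> c k j) 0 by exact: is_derive_cst.
refine (is_derive_eq (is_derive_mulE h h0) _); by rewrite mulr0 addr0.
Qed.

Lemma fundamental_mx_mulmx_continuous p (lam : R) (c : 'M[R]_(n.+1, p)) i j :
  {within `[0, L], continuous (fun t => (U lam t *m c) i j)}.
Proof.
move=> x; have [_ cU _] := UP lam.
have FF := nbhs_subspace_filter x.
apply: (cvg_mulmx (A := fun t => U lam t) (B := fun=> c)) => k l; last exact: cvg_cst.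
exact: cU.
Qed.

(** The squared norms of [c] and of the solution [U(x) c] are comparable,
    uniformly in [x] and in bounded [lam]. *)
Lemma fundamental_mx_growth (Lam : R) : exists2 G : R, 1 <= G &
  forall lam (c : 'cV[R]_n.+1) (x : R), `|lam| <= Lam -> x \in `[0, L] ->
    \sum_i (U lam x *m c) i 0 ^+ 2 <= G * \sum_i c i 0 ^+ 2 /\
    \sum_i c i 0 ^+ 2 <= G * \sum_i (U lam x *m c) i 0 ^+ 2.
Proof.
have [K K0 KP] := coef_mx_bound.
exists (expR ((2 * (K + `|Lam|) * N + 1) * L)).
  rewrite -[X in X <= _]expR0 ler_expR; apply: mulr_ge0; last exact: ltW.
  by rewrite addr_ge0 ?ler01// !mulr_ge0 ?addr_ge0 ?normr_ge0// ltW.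
move=> lam c x lamL xL.
have KL : 0 <= K + `|Lam| by rewrite addr_ge0.
have := @linear_system_bound R n.+1 L (K + `|Lam|) 0
  (fun x => coef_mx eps A0 x lam) (fun x => U lam x *m c) (fun=> 0) KL _ _ _ _ x xL.
have [U0 _ _] := UP lam.
rewrite /= expr0n/= mulr0 mul0r !addr0 U0 mul1mx; apply.
- move=> y yL i j; apply: le_trans (KP _ _ _ _ (open_in_itv yL)) _.
  by rewrite lerD2l (le_trans lamL)// ler_norm.
- by move=> y _ i; rewrite mxE normr0.
- by move=> i; exact: fundamental_mx_mulmx_continuous.
- by move=> y yL i; rewrite addr0; exact: fundamental_mx_mulmx.
Qed.

(** A vector in the kernel of [U(x)] is zero, by the backward estimate. *)
Lemma fundamental_mx_unit lam x : x \in `[0, L] -> U lam x \in unitmx.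
Proof.
move=> xL; rewrite -unitmx_tr unitmxE unitfE; apply/det0P => -[v vN0 v0].
have [G G1 GP] := fundamental_mx_growth `|lam|.
have [_] := GP lam v^T x (lexx _) xL.
rewrite -[U lam x *m v^T]trmxK trmx_mul trmxK v0.
rewrite [X in _ <= _ * X -> _]big1 ?mulr0 => [h|i _]; last by rewrite !mxE expr0n.
move/negP : vN0; apply; apply/eqP/rowP => i; rewrite mxE.
have : v 0 i ^+ 2 <= 0.
  apply: le_trans h; rewrite (bigD1 i)//= mxE lerDl.
  by apply: sumr_ge0 => j _; exact: sqr_ge0.
by rewrite real_exprn_even_le0 ?num_real//= => /eqP.
Qed.

Lemma fundamental_mx_bound (Lam : R) : exists2 K : R, 0 <= K &
  forall lam (x : R) i j, `|lam| <= Lam -> x \in `[0, L] ->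
    `|U lam x i j| <= K /\ `|invmx (U lam x) i j| <= K.
Proof.
have [G G1 GP] := fundamental_mx_growth Lam.
exists (G + 1); first lra.
have G0 : 0 <= G by lra.
move=> lam x i j lamL xL; split.
  rewrite -[G + 1]mulr1 -[X in _ <= _ * X]normr1; apply: sqr_le_norm_le => //.
  rewrite expr1n mulr1 mxE_delta.
  have [h _] := GP lam (delta_mx j 0) _ lamL xL.
  by apply: le_trans (le_sum_sqr _ _) (le_trans h _); rewrite sum_sqr_delta mulr1.
rewrite -[G + 1]mulr1 -[X in _ <= _ * X]normr1; apply: sqr_le_norm_le => //.
rewrite expr1n mulr1 mxE_delta.
have [_ h] := GP lam (invmx (U lam x) *m delta_mx j 0) _ lamL xL.
apply: le_trans (le_sum_sqr _ _) (le_trans h _).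
by rewrite mulmxA mulmxV ?fundamental_mx_unit// mul1mx sum_sqr_delta mulr1.
Qed.

(** The difference of two fundamental matrices solves the system for [mu], with
    zero initial value and a forcing term proportional to [mu - lam]. *)
Lemma fundamental_mx_lipschitz_lam (Lam : R) : exists2 K : R, 0 <= K &
  forall lam mu (x : R) i j, `|lam| <= Lam -> `|mu| <= Lam -> x \in `[0, L] ->
    `|U mu x i j - U lam x i j| <= K * `|mu - lam|.
Proof.
have [K K0 KP] := coef_mx_bound.
have [KU KU0 KUP] := fundamental_mx_bound Lam.
pose G := expR ((2 * (K + `|Lam|) * N + 1) * L).
have G0 : 0 < G by exact: expR_gt0.
pose C := G * (N * KU ^+ 2 * L).
have C0 : 0 <= C.
  exact: mulr_ge0 (ltW G0) (mulr_ge0 (mulr_ge0 (ltW N_gt0) (sqr_ge0 _)) (ltW L0)).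
exists (C + 1); first lra.
move=> lam mu x i j lamL muL xL.
have KL : 0 <= K + `|Lam| by rewrite addr_ge0.
pose w y : 'cV[R]_n.+1 := (U mu y - U lam y) *m delta_mx j 0.
pose r y : 'cV[R]_n.+1 :=
  (coef_mx eps A0 y mu - coef_mx eps A0 y lam) *m (U lam y *m delta_mx j 0).
have dE y k l : (coef_mx eps A0 y mu - coef_mx eps A0 y lam) k l =
    eps * (mu - lam) * ((k == ord_max)%:R * (l == ord0)%:R).
  by rewrite [LHS]mxE [X in _ + X]mxE !coef_mxE; ring.
have rE y k : r y k 0 = eps * (mu - lam) * (k == ord_max)%:R * U lam y 0 j.
  rewrite /r [LHS]mxE (bigD1 0)//= big1 ?addr0 => [|l l0].
    by rewrite -mxE_delta dE eqxx mulr1.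
  by rewrite dE (negbTE l0) !mulr0 mul0r.
have := @linear_system_bound R n.+1 L (K + `|Lam|) (`|mu - lam| * KU)
  (fun x => coef_mx eps A0 x mu) w r KL.
have [U0 cU dU] := UP lam.
have [U0' cU' dU'] := UP mu.
have wE y k : w y k 0 = U mu y k j - U lam y k j by rewrite /w -mxE_delta !mxE.
have wf k : (fun y => w y k 0) = (fun y => U mu y k j - U lam y k j).
  by apply/funext => y; rewrite wE.
have w0 : w 0 = 0 by apply/colP => k; rewrite wE U0 U0' subrr mxE.
move=> h; rewrite -wE; apply: sqr_le_norm_le => //.
apply: le_trans (le_sum_sqr _ _) _.
have -> : C * (mu - lam) ^+ 2 = G * (\sum_k w 0 k 0 ^+ 2 + N * (`|mu - lam| * KU) ^+ 2 * L).
  rewrite w0 big1 => [|k _]; last by rewrite mxE expr0n.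
  by rewrite exprMn real_normK ?num_real// /C; ring.
apply: (h _ _ _ _ x xL).1.
- move=> y yL k l; apply: le_trans (KP _ _ _ _ (open_in_itv yL)) _.
  by rewrite lerD2l (le_trans muL)// ler_norm.
- move=> y yL k; rewrite rE !normrM norm_eps mul1r normr_nat.
  have [h1 _] := KUP lam y 0 j lamL (open_in_itv yL).
  apply: ler_pM => //.
  by case: eqP; rewrite ?(mulr1, mulr0).
- by move=> k y; rewrite wf; apply: cvgB; [exact: cU'|exact: cU].
- move=> y yL k; rewrite wf.
  refine (is_derive_eq (is_deriveB (dU' _ yL k j) (dU _ yL k j)) _).
  rewrite /w /r mulmxBl mulmxBr mulmxBl !mulmxA.
  rewrite (mxE_delta _ k j) [X in _ - X = _]mxE_delta.
  by rewrite addrA subrK [RHS]mxE [X in _ = _ + X]mxE.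
Qed.

Lemma fundamental_mx_lipschitz lam : exists2 K : R, 0 <= K &
  forall (s t : R) i j, s \in `[0, L] -> t \in `[0, L] ->
    `|U lam t i j - U lam s i j| <= K * `|t - s|.
Proof.
have [K K0 KP] := coef_mx_bound.
have [KU KU0 KUP] := fundamental_mx_bound `|lam|.
pose C := N * ((K + `|lam|) * KU).
have C0 : 0 <= C.
  exact: mulr_ge0 (ltW N_gt0) (mulr_ge0 (addr_ge0 K0 (normr_ge0 _)) KU0).
have [_ cU dU] := UP lam.
exists C => //.
have main s t i j : s \in `[0, L] -> t \in `[0, L] -> s <= t ->
    `|U lam t i j - U lam s i j| <= C * `|t - s|.
  rewrite !in_itv/= => /andP[s0 sL] /andP[t0 tL] st.
  have [/eqP ->|sNt] := boolP (s == t); first by rewrite !subrr !normr0 mulr0.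
  have {sNt}st : s < t by rewrite lt_neqAle sNt.
  have sub x : x \in `]s, t[ -> x \in `]0, L[.
    rewrite !in_itv/= => /andP[sx xt]; lra.
  have [|c cst ->] := @MVT R (fun x => U lam x i j) _ s t st
    (fun x xst => dU x (sub x xst) i j).
    apply: continuous_subspaceW (cU i j) => x /=; rewrite !in_itv/=; lra.
  rewrite normrM ler_wpM2r// mxE.
  apply: le_trans (ler_norm_sum _ _ _) _.
  rewrite /C /N mulr_natl -[X in _ *+ X]card_ord -sumr_const; apply: ler_sum => k _.
  have cL := open_in_itv (sub _ cst).
  by rewrite normrM; apply: ler_pM => //; [exact: KP|exact: (KUP _ _ _ _ _ cL).1].
move=> s t i j sL tL; have [st|/ltW ts] := leP s t; first exact: main.
by rewrite distrC [`|t - s|]distrC; exact: main.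
Qed.

End fundamental.

(** * Square-integrable real functions on [0, L] *)

Section almost_everywhere.
Context {R : realType}.
Local Notation mu := (@lebesgue_measure R).
Implicit Types P Q : R -> Prop.

Lemma ae_impl P Q : (forall x, P x -> Q x) ->
  {ae mu, forall x, P x} -> {ae mu, forall x, Q x}.
Proof. by move=> PQ; apply: negligibleS => x /= h /PQ. Qed.

Lemma ae_conj P Q : {ae mu, forall x, P x} -> {ae mu, forall x, Q x} ->
  {ae mu, forall x, P x /\ Q x}.
Proof.
move=> p q; have := negligibleU p q.
by apply: negligibleS => x /= h; apply/not_andP.
Qed.

Lemma ae_forall_fin (I : finType) (P : I -> R -> Prop) :
  (forall i, {ae mu, forall x, P i x}) -> {ae mu, forall x, forall i, P i x}.
Proof.
move=> aeP.
have : {ae mu, forall x, forall i, i \in enum I -> P i x}.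
  elim: (enum I) => [|i s ih]; first exact/aeW.
  apply: ae_impl (ae_conj (aeP i) ih) => x [Pi Ps] j.
  by rewrite inE => /predU1P[->//|/Ps].
by apply: ae_impl => x h i; apply: h; rewrite mem_enum.
Qed.

End almost_everywhere.

(** Near a point of [0, L] where a continuous function does not vanish there
    is a nondegenerate subinterval, of positive measure, where it does not
    vanish. *)
Lemma continuous_ae_eq0 {R : realType} (L : R) (y : R -> R) : 0 < L ->
  {within `[0, L], continuous y} ->
  {ae @lebesgue_measure R, forall x, `[0, L]%classic x -> y x = 0} ->
  forall x, x \in `[0, L] -> y x = 0.
Proof.
move=> L0 cy y0 x xL; apply: contrapT => /eqP yx.
have xP : 0 <= x <= L by move: xL; rewrite in_itv.
have : \forall t \near within `[0, L] (nbhs x), y t != 0.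
  have := (subspace_continuousP _ _).1 cy x xL.
  move=> /(_ [set z | z != 0]); apply.
  by apply: open_nbhs_nbhs; split => //; exact: open_neq.
rewrite near_withinE => -[d /= d0 dP].
have [a [b [ab abD abx]]] : exists a b, [/\ a < b, 0 <= a /\ b <= L &
    forall t, a < t < b -> `|x - t| < d].
  have [xltL|Lx] := ltP x L.
    exists x, (Num.min L (x + d)); split.
    - by rewrite lt_min xltL ltrDl.
    - by split; [lra|rewrite ge_min lexx].
    - by move=> t; rewrite lt_min ltr_norml; lra.
  exists (Num.max 0 (x - d)), x; split.
  - by rewrite gt_max; lra.
  - by split; [rewrite le_max lexx|lra].
  - by move=> t; rewrite gt_max ltr_norml; lra.
have : (@lebesgue_measure R).-negligible (`]a, b[%classic : set R).
  apply: negligibleS y0 => t /=; rewrite in_itv/= => tab.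
  have tL : `[0, L]%classic t by rewrite /= in_itv/=; lra.
  move=> h; have /eqP := dP t (abx t tab) tL; apply; exact: h.
move/negligibleP => /(_ (measurable_itv _)); rewrite /= lebesgue_measure_itv/= lte_fin ab.
by move/eqP; rewrite -EFinD eqe subr_eq0 gt_eqF.
Qed.

Section square_integrable.
Context {R : realType} (L : R).
Local Notation mu := (@lebesgue_measure R).
Local Notation D := (`[0, L]%classic : set R).
Implicit Types f g h : R -> R.

(** Real square-integrable functions on [0, L]; values outside [0, L] are
    irrelevant. *)
Definition square_integrable f : Prop :=
  measurable_fun D f /\ mu.-integrable D (EFin \o (fun x => f x ^+ 2)).

Lemma lebesgue_itv_fin : (mu D < +oo)%E.
Proof. by rewrite /= lebesgue_measure_itv/=; case: ifP => _; rewrite ltry. Qed.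

Lemma le_integrable_fin f g : measurable_fun D f ->
  (forall x, D x -> `|f x| <= g x) ->
  mu.-integrable D (EFin \o g) -> mu.-integrable D (EFin \o f).
Proof.
move=> mf fg ig; apply: le_integrable ig => //; first exact/measurable_EFinP.
by move=> x Dx /=; rewrite lee_fin (le_trans (fg _ Dx))// ler_norm.
Qed.

Lemma integrable_cst_itv (c : R) : mu.-integrable D (EFin \o (fun=> c)).
Proof.
apply: measurable_bounded_integrable => //; first exact: lebesgue_itv_fin.
exists `|c|; split; first exact: num_real.
by move=> M cM x _ /=; exact: ltW.
Qed.

Lemma integrable_addr f g : mu.-integrable D (EFin \o f) ->
  mu.-integrable D (EFin \o g) -> mu.-integrable D (EFin \o (fun x => f x + g x)).
Proof.
by move=> fi gi; apply: eq_integrable (integrableD _ fi gi) => //.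
Qed.

Lemma integrable_mulr c f : mu.-integrable D (EFin \o f) ->
  mu.-integrable D (EFin \o (fun x => c * f x)).
Proof.
by move=> fi; apply: eq_integrable (integrableZl _ c fi) => //.
Qed.

Lemma integrable_sumr (I : Type) (r : seq I) (g : I -> R -> R) :
  (forall i, mu.-integrable D (EFin \o g i)) ->
  mu.-integrable D (EFin \o (fun x => \sum_(i <- r) g i x)).
Proof.
move=> ig; elim: r => [|i s ih].
  rewrite (_ : (fun x => _) = (fun=> 0)); first exact: integrable_cst_itv.
  by apply/funext => x; rewrite big_nil.
rewrite (_ : (fun x => _) = (fun x => g i x + \sum_(j <- s) g j x)).
  exact: integrable_addr.
by apply/funext => x; rewrite big_cons.
Qed.

Lemma Rintegral_sum (I : Type) (r : seq I) (g : I -> R -> R) :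
  (forall i, mu.-integrable D (EFin \o g i)) ->
  \int[mu]_(x in D) (\sum_(i <- r) g i x) = \sum_(i <- r) \int[mu]_(x in D) g i x.
Proof.
move=> ig.
elim: r => [|i r ih].
  by rewrite big_nil; under eq_Rintegral do rewrite big_nil; rewrite Rintegral_cst// mul0r.
rewrite big_cons -ih -RintegralD//; last exact: integrable_sumr.
apply: eq_Rintegral => x _.
by rewrite big_cons.
Qed.

Lemma square_integrable_mul f g :
  square_integrable f -> square_integrable g ->
  mu.-integrable D (EFin \o (fun x => f x * g x)).
Proof.
move=> [mf f2] [mg g2].
apply: (le_integrable_fin (g := fun x => f x ^+ 2 + g x ^+ 2)).
- exact: measurable_funM.
- move=> x _; rewrite normrM -[f x ^+ 2]real_normK ?num_real//.
  rewrite -[g x ^+ 2]real_normK ?num_real//.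
  have := sqr_ge0 (`|f x| - `|g x|); have := sqr_ge0 (`|f x| + `|g x|); nra.
- exact: integrable_addr.
Qed.

Lemma square_integrable_bounded f K : measurable_fun D f ->
  (forall x, D x -> `|f x| <= K) -> square_integrable f.
Proof.
move=> mf fK; split => //.
apply: (le_integrable_fin (g := fun=> K ^+ 2)); last exact: integrable_cst_itv.
  exact: measurable_funX.
by move=> x Dx; rewrite normrX lerXn2r ?nnegrE ?fK// (le_trans _ (fK _ Dx)).
Qed.

Lemma square_integrable0 : square_integrable (fun=> 0).
Proof. by apply: (@square_integrable_bounded _ 0) => // x _; rewrite normr0. Qed.

Lemma square_integrable_integrable f :
  square_integrable f -> mu.-integrable D (EFin \o f).
Proof.
move=> sf.
have s1 : square_integrable (fun=> 1).
  by apply: (@square_integrable_bounded _ 1) => // x _; rewrite normr1.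
have := square_integrable_mul sf s1; apply: eq_integrable => // x _.
by rewrite /= mulr1.
Qed.

Lemma square_integrable_bounded_mul f g K : measurable_fun D g ->
  (forall x, D x -> `|g x| <= K) -> square_integrable f ->
  square_integrable (fun x => g x * f x).
Proof.
move=> mg gK [mf f2]; split; first exact: measurable_funM.
apply: (le_integrable_fin (g := fun x => K ^+ 2 * f x ^+ 2)).
- by apply: measurable_funX; exact: measurable_funM.
- move=> x Dx; rewrite exprMn normrM [`|f x ^+ 2|]ger0_norm ?sqr_ge0//.
  rewrite ler_wpM2r ?sqr_ge0// normrX lerXn2r ?nnegrE ?gK//.
  by rewrite (le_trans _ (gK _ Dx)).
- exact: integrable_mulr.
Qed.

Lemma square_integrableZ c f :
  square_integrable f -> square_integrable (fun x => c * f x).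
Proof. exact: (@square_integrable_bounded_mul f (fun=> c) `|c|). Qed.

Lemma square_integrableD f g : square_integrable f -> square_integrable g ->
  square_integrable (fun x => f x + g x).
Proof.
move=> sf sg; have [mf f2] := sf; have [mg g2] := sg.
split; first exact: measurable_funD.
apply: (le_integrable_fin (g := fun x => 2 * (f x ^+ 2 + g x ^+ 2))).
- by apply: measurable_funX; exact: measurable_funD.
- move=> x _; rewrite ger0_norm ?sqr_ge0//.
  have := sqr_ge0 (f x - g x); nra.
- by apply: integrable_mulr; exact: integrable_addr.
Qed.

Lemma square_integrableB f g : square_integrable f -> square_integrable g ->
  square_integrable (fun x => f x - g x).
Proof.
move=> sf /(square_integrableZ (-1)) sg.
have := square_integrableD sf sg.
by under [X in square_integrable X -> _]eq_fun do rewrite mulN1r.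
Qed.

Lemma eq_square_integrable f g : (forall x, D x -> f x = g x) ->
  square_integrable f -> square_integrable g.
Proof.
move=> fg [mf f2]; split.
  by apply: eq_measurable_fun mf => x; rewrite inE => /fg.
by apply: eq_integrable f2 => // x; rewrite inE => /fg /= ->.
Qed.

(** The Cauchy-Schwarz inequality, by the sign of a quadratic polynomial. *)
Lemma cauchy_schwarz_itv f g : square_integrable f -> square_integrable g ->
  (\int[mu]_(x in D) (f x * g x)) ^+ 2 <=
  (\int[mu]_(x in D) (f x ^+ 2)) * (\int[mu]_(x in D) (g x ^+ 2)).
Proof.
move=> sf sg; have [_ f2] := sf; have [_ g2] := sg.
have fg := square_integrable_mul sf sg.
set a := \int[mu]_(x in D) (f x ^+ 2); set c := \int[mu]_(x in D) (g x ^+ 2).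
set b := \int[mu]_(x in D) (f x * g x).
have a0 : 0 <= a by apply: Rintegral_ge0 => x _; exact: sqr_ge0.
have c0 : 0 <= c by apply: Rintegral_ge0 => x _; exact: sqr_ge0.
have h t : 0 <= t ^+ 2 * a + 2 * t * b + c.
  have -> : t ^+ 2 * a + 2 * t * b + c = \int[mu]_(x in D) ((t * f x + g x) ^+ 2).
    rewrite /a /b /c -!RintegralZl// -!RintegralD//.
    - by apply: eq_Rintegral => x _; ring.
    - by apply: integrable_addr; exact: integrable_mulr.
    - exact: integrable_mulr.
    - exact: integrable_mulr.
  by apply: Rintegral_ge0 => x _; exact: sqr_ge0.
have [a_eq0|aN0] := eqVneq a 0.
  have [->|bN0] := eqVneq b 0; first by rewrite expr0n/= mulr_ge0.
  have := h (- (c + 1) / (2 * b)).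
  rewrite a_eq0 mulr0 add0r.
  rewrite (_ : 2 * (- (c + 1) / (2 * b)) * b = - (c + 1)); last by field.
  lra.
have := h (- b / a).
rewrite (_ : _ + c = (a * c - b ^+ 2) / a); last by field.
rewrite pmulr_lge0 ?invr_gt0 ?lt_def ?aN0//; lra.
Qed.

Lemma Rintegral_sqr_eq0 f : square_integrable f ->
  \int[mu]_(x in D) (f x ^+ 2) = 0 -> {ae mu, forall x, D x -> f x = 0}.
Proof.
move=> [mf f2] f0.
have : ae_eq mu D (EFin \o (fun x => f x ^+ 2)) (cst 0).
  apply/ae_eq_integral_abs => //.
    by apply/measurable_EFinP; exact: measurable_funX.
  under eq_integral => x _ do rewrite gee0_abs ?lee_fin ?sqr_ge0//.
  have ffin : (\int[mu]_(x in D) (f x ^+ 2)%:E)%E \is a fin_num by exact: integrable_fin_num.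
  by rewrite -[LHS]fineK// -[X in X%:E]/(\int[mu]_(x in D) (f x ^+ 2)) f0.
apply: ae_impl => x /= h /h /eqP; rewrite eqe sqrf_eq0 => /eqP //.
Qed.

Lemma ae_Rintegral_sqr_eq f g : square_integrable f -> square_integrable g ->
  {ae mu, forall x, D x -> f x = g x} ->
  \int[mu]_(x in D) (f x ^+ 2) = \int[mu]_(x in D) (g x ^+ 2).
Proof.
move=> [mf _] [mg _] fg; congr fine; apply: ae_eq_integral => //.
- by apply/measurable_EFinP; exact: measurable_funX.
- by apply/measurable_EFinP; exact: measurable_funX.
- by apply: ae_impl fg => x h /h /= ->.
Qed.

End square_integrable.

(** * Absolutely continuous functions *)

Section absolute_continuity.
Context {R : realType} (a b : R).
Implicit Types f g h : R -> R.

(** Domination of the increments: sums, products and Lipschitz functions all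
    reduce to this. *)
Lemma abs_continuous_dom f g h (K : R) :
  (forall s t, s \in `[a, b] -> t \in `[a, b] ->
     `|f t - f s| <= K * (`|g t - g s| + `|h t - h s|)) ->
  abs_continuous a b g -> abs_continuous a b h -> abs_continuous a b f.
Proof.
move=> fgh ag ah e e0.
pose c := e / (2 * (`|K| + 1)).
have K0 : 0 <= `|K| by [].
have c0 : 0 < c by rewrite divr_gt0//; lra.
have [d1 d10 h1] := ag _ c0; have [d2 d20 h2] := ah _ c0.
exists (Num.min d1 d2); first by rewrite lt_min d10 d20.
move=> m s t st tst; rewrite lt_min => /andP[sd1 sd2].
have {}h1 := h1 _ _ _ st tst sd1; have {}h2 := h2 _ _ _ st tst sd2.
apply: (@le_lt_trans _ _ (`|K| *
    (\sum_i `|g (t i) - g (s i)| + \sum_i `|h (t i) - h (s i)|))).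
  rewrite -big_split/= mulr_sumr; apply: ler_sum => i _.
  have [as_ [st_ tb]] := st i.
  apply: le_trans (fgh _ _ _ _) _.
  - by rewrite in_itv/= as_/= (le_trans st_ tb).
  - by rewrite in_itv/= tb andbT (le_trans as_ st_).
  - by rewrite ler_wpM2r ?addr_ge0// ler_norm.
have -> : e = (`|K| + 1) * (c + c) by rewrite /c; field; lra.
have : 0 <= \sum_i `|g (t i) - g (s i)| by apply: sumr_ge0.
have : 0 <= \sum_i `|h (t i) - h (s i)| by apply: sumr_ge0.
nra.
Qed.

Lemma abs_continuous_id : abs_continuous a b id.
Proof.
move=> e e0; exists e => // m s t st _; apply: le_lt_trans.
by apply: ler_sum => i _; rewrite ger0_norm// subr_ge0; have [_ []] := st i.
Qed.

Lemma abs_continuous_lipschitz f K :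
  (forall s t, s \in `[a, b] -> t \in `[a, b] -> `|f t - f s| <= K * `|t - s|) ->
  abs_continuous a b f.
Proof.
move=> fK; apply: (@abs_continuous_dom f id id `|K|) abs_continuous_id abs_continuous_id.
move=> s t sab tab; apply: le_trans (fK _ _ sab tab) _ => /=.
have : K * `|t - s| <= `|K| * `|t - s| by rewrite ler_wpM2r// ler_norm.
have : 0 <= `|K| * `|t - s| by rewrite mulr_ge0.
lra.
Qed.

Lemma abs_continuousD f g : abs_continuous a b f -> abs_continuous a b g ->
  abs_continuous a b (fun x => f x + g x).
Proof.
apply: (@abs_continuous_dom _ f g 1) => s t _ _; rewrite mul1r.
by rewrite opprD addrACA; exact: ler_normD.
Qed.

Lemma abs_continuousM f g K :
  (forall x, x \in `[a, b] -> `|f x| <= K) ->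
  (forall x, x \in `[a, b] -> `|g x| <= K) ->
  abs_continuous a b f -> abs_continuous a b g ->
  abs_continuous a b (fun x => f x * g x).
Proof.
move=> fK gK; apply: (@abs_continuous_dom _ f g K) => s t sab tab.
rewrite (_ : _ - _ = (f t - f s) * g t + f s * (g t - g s)); last by ring.
apply: le_trans (ler_normD _ _) _; rewrite !normrM mulrDr mulrC.
by apply: lerD; rewrite ler_wpM2r// ?fK ?gK.
Qed.

Lemma abs_continuous_cst c : abs_continuous a b (fun=> c).
Proof.
by apply: (@abs_continuous_lipschitz _ 0) => s t _ _; rewrite subrr normr0 mul0r.
Qed.

Lemma abs_continuous_sum (I : Type) (r : seq I) (f : I -> R -> R) :
  (forall i, abs_continuous a b (f i)) ->
  abs_continuous a b (fun x => \sum_(i <- r) f i x).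
Proof.
move=> af; elim: r => [|i r ih].
  rewrite (_ : (fun x => _) = (fun=> 0)); first exact: abs_continuous_cst.
  by apply/funext => x; rewrite big_nil.
rewrite (_ : (fun x => _) = (fun x => f i x + \sum_(i <- r) f i x)).
  exact: abs_continuousD.
by apply/funext => x; rewrite big_cons.
Qed.

End absolute_continuity.

Section primitive.
Context {R : realType} (L : R) (q : R -> R).
Local Notation mu := (@lebesgue_measure R).
Local Notation D := (`[0, L]%classic : set R).
Hypothesis L0 : 0 < L.
Hypothesis iq : mu.-integrable D (EFin \o q).

(** The primitive of [q] that vanishes at 0. *)
Definition primitive (x : R) : R := \int[mu]_(t in `[0, x]) q t.

Lemma primitive0 : primitive 0 = 0.
Proof. by rewrite /primitive set_itv1 Rintegral_set1. Qed.

Lemma integrable_subitv (i : interval R) : [set` i] `<=` D ->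
  mu.-integrable [set` i] (EFin \o q).
Proof. by move=> iD; apply: integrableS iq. Qed.

Lemma primitiveB s t : 0 <= s -> s <= t -> t <= L ->
  primitive t - primitive s = \int[mu]_(x in `]s, t]) q x.
Proof.
move=> s0 st tL; rewrite /primitive Rintegral_itvB//.
apply: integrable_subitv => x /=; rewrite !in_itv/=; lra.
Qed.

Lemma primitive_bounded x : x \in `[0, L] ->
  `|primitive x| <= \int[mu]_(t in D) `|q t|.
Proof.
rewrite in_itv/= => /andP[x0 xL].
have sub : (`[0, x] `<=` D)%classic by move=> y /=; rewrite !in_itv/=; lra.
apply: le_trans (le_normr_Rintegral _ _) _ => //; first exact: integrable_subitv.
have ia : mu.-integrable D (EFin \o (fun t => `|q t|)) by exact: integrable_norm.
rewrite -lee_fin /Rintegral !fineK ?integrable_fin_num//; last first.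
  exact: integrableS ia.
by apply: ge0_subset_integral => //; case/integrableP : ia.
Qed.

(** The total increment over disjoint intervals is at most the integral of |q|
    over their union, which is small when the union has small measure. *)
Lemma abs_continuous_primitive : abs_continuous 0 L primitive.
Proof.
move=> e e0; pose qD := q \_ D.
have iqD : mu.-integrable setT (EFin \o qD).
  rewrite -restrict_EFin; apply/integrable_restrict => //=; by rewrite setTI.
have [d [d0 dP]] := integral_normr_continuous iqD e0.
exists d => // m s t st tst std.
pose A := \big[setU/set0]_(i < m) (`]s i, t i[%classic : set R).
have mA : measurable A by exact: bigsetU_measurable.
have muA : mu A = (\sum_(i < m) (t i - s i))%:E.
  rewrite /A measure_semi_additive_ord// -sumEFin; apply: eq_bigr => i _.
  rewrite /= lebesgue_measure_itv/= lte_fin; have [_ [sti _]] := st i.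
  case: ltP => [_|tsi]; first by rewrite EFinN EFinD.
  by have -> : s i = t i by [apply/eqP; rewrite eq_le sti]; rewrite subrr.
have {}muA : (mu A < d%:E)%E by rewrite muA lte_fin.
apply: le_lt_trans (dP A mA muA).
have sub i : (`]s i, t i[ `<=` D)%classic.
  by have [si [sti ti]] := st i; move=> y /=; rewrite !in_itv/=; lra.
have inq (B : set R) : measurable B -> B `<=` D -> mu.-integrable B (EFin \o (fun x => `|qD x|)).
  move=> mB BD; apply: integrable_norm => //.
  by apply: integrableS iqD.
have -> : \int[mu]_(x in A) `|qD x| = \sum_(i < m) \int[mu]_(x in `]s i, t i[) `|qD x|.
  rewrite /Rintegral ge0_integral_bigsetU//.
  - rewrite sum_fine// => i _; apply: integrable_fin_num => //.
    by apply: inq => //; apply: sub.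
  - exact: index_enum_uniq.
  - by apply: sub_trivIset tst.
  - have : mu.-integrable setT (EFin \o (fun x => `|qD x|)) by exact: integrable_norm.
    by case/integrableP => mqD _; exact: measurable_funS mqD.
apply: ler_sum => i _; have [si [sti ti]] := st i.
rewrite primitiveB// -Rintegral_itv_bndo_bndc; last first.
  by apply: integrable_subitv; exact: sub.
apply: le_trans (le_normr_Rintegral _ _) _ => //.
  by apply: integrable_subitv; exact: sub.
rewrite le_eqVlt; apply/orP; left; apply/eqP; apply: eq_Rintegral => x.
by rewrite inE => /sub xD; rewrite /qD patchE mem_set.
Qed.

(** Lebesgue's differentiation theorem, applied to the extension of [q] by
    zero. *)
Lemma primitive_derive :
  {ae mu, forall x, x \in `]0, L[ -> is_derive x (1 : R) primitive (q x)}.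
Proof.
pose qD := q \_ D.
have iqD : mu.-integrable setT (EFin \o qD).
  rewrite -restrict_EFin; apply/integrable_restrict => //=; by rewrite setTI.
have loc : locally_integrable setT qD.
  exact: integrable_locally.
have := @FTC1 R qD (BLeft 0) (fun y => integrableS _ _ _ iqD) loc.
move=> /(_ measurableT) /(_ (fun=> measurable_itv _)) /(_ (fun=> @subsetT _ _)).
move=> aeF; pose F x : R := \int[mu]_(t in `[0, x]) qD t.
have {}aeF : {ae mu, forall x, (0%:E < x%:E)%E ->
  derivable F x (1 : R) /\ derive1 F x = qD x}.

  exact: aeF.
apply: ae_impl aeF => x h xL.

have x0L : 0 < x < L by move: xL; rewrite in_itv.
have [|dF Fq] := h; first by rewrite lte_fin; case/andP: x0L.
have xD : x \in D by rewrite inE/= in_itv/=; lra.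
have FE : \forall y \near x, F y = primitive y.
  have /andP[_ xltL] := x0L; have := lt_nbhsl xltL; apply: filterS => y yL.
  apply: eq_Rintegral => z.
  rewrite inE/= in_itv/= => /andP[z0 zy]; rewrite /qD patchE mem_set//=.
  by rewrite in_itv/= z0/= (le_trans zy)// ltW.
apply: (near_eq_is_derive FE); apply: DeriveDef => //.
by rewrite -derive1E Fq /qD patchE xD.
Qed.

End primitive.

(** * Variation of constants and the Green function *)

(** Boundary conditions for a real vector function, in terms of its values at
    the two end points. *)
Definition real_bc (R : realType) (n : nat) (bc : boundary R n)
    (u0 uL : 'cV[R]_n) : Prop :=
  match bc with
  | Separated k BL BR _ => BL *m u0 = 0 /\ BR *m uL = 0
  | Periodic => u0 = uL
  end.

Section green.
Context {R : realType} (n : nat) (L eps : R).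
Variables (A0 : R -> 'M[R]_n.+1) (bc : boundary R n.+1).
Variable (U : R -> R -> 'M[R]_n.+1).
Hypotheses (L0 : 0 < L) (eps1 : eps = 1 \/ eps = -1).
Hypothesis A0_smooth : forall i j, smooth_on 0 L (fun x => A0 x i j).
Hypothesis bc_wf : boundary_wf bc.
Hypothesis UP : fundamental_mx L eps A0 U.
Local Notation mu := (@lebesgue_measure R).
Local Notation D := (`[0, L]%classic : set R).
Let U_unit := fundamental_mx_unit L0 eps1 A0_smooth UP.
Let U_bound := fundamental_mx_bound L0 eps1 A0_smooth UP.

Lemma fundamental_mx_continuous lam i j :
  {within D, continuous (fun x => U lam x i j)}.
Proof. by have [_ cU _] := UP lam; exact: cU. Qed.

Lemma invmx_fundamental_continuous lam i j :
  {within D, continuous (fun x => invmx (U lam x) i j)}.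
Proof.
apply/subspace_continuousP => x xD; apply: cvg_invmx; last first.
- by move=> k l; move: x xD; apply/subspace_continuousP; exact: fundamental_mx_continuous.
- exact: U_unit.
by near=> y; apply: U_unit; near: y; exact: withinT.
Unshelve. all: by end_near. Qed.

Lemma fundamental_mx_measurable lam i j : measurable_fun D (fun x => U lam x i j).
Proof.
by apply: subspace_continuous_measurable_fun => //; exact: fundamental_mx_continuous.
Qed.

Lemma invmx_fundamental_measurable lam i j :
  measurable_fun D (fun x => invmx (U lam x) i j).
Proof.
by apply: subspace_continuous_measurable_fun => //; exact: invmx_fundamental_continuous.
Qed.

(** The entry of the Green matrix as a sum in which the variables separate,
    apart from the jump of height E across the diagonal. *)
Lemma greenE lam x s : green L bc U x s lam =
  \sum_j U lam x 0 j * ((if s < x then evans L bc U lam else 0) * invmx (U lam s) j ord_max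
    - \sum_k evans_P L bc U lam j k * invmx (U lam s) k ord_max).
Proof.
have aux (A B C : 'M[R]_n.+1) : (A *m B *m C) ord0 ord_max =
    \sum_j A 0 j * \sum_k B j k * C k ord_max.
  by rewrite -mulmxA mxE; apply: eq_bigr => j _; rewrite mxE.
rewrite /green /green_mx; case: ifPn => _.
  rewrite mulmxBr mulmxBl [LHS]mxE [X in _ + X]mxE !aux -sumrB.
  apply: eq_bigr => j _; rewrite -mulrBr; congr (_ * (_ - _)).
  rewrite (bigD1 j)//= big1 => [|k /negbTE kj]; last by rewrite mxE eq_sym kj mulr0n mul0r.
  by rewrite mxE eqxx mulr1n addr0.
rewrite mxE aux -sumrN; apply: eq_bigr => j _.
by rewrite mul0r sub0r mulrN.
Qed.

Section solution.
Variables (lam : R) (f : R -> R).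
Hypothesis f2 : square_integrable L f.
Let E := evans L bc U lam.
Let P := evans_P L bc U lam.
Hypothesis E0 : E != 0.

(* the forcing term of the system for U^-1 u, that is, U^-1 e_n eps f *)
Let q (j : 'I_n.+1) s := invmx (U lam s) j ord_max * (eps * f s).

Lemma forcing_integrable j : mu.-integrable D (EFin \o q j).
Proof.
apply: square_integrable_integrable.
have [K K0 KP] := U_bound `|lam|.
apply: (@square_integrable_bounded_mul _ _ _ _ K).
- exact: invmx_fundamental_measurable.
- by move=> x xD; have [] := KP lam x j ord_max (lexx _) xD.
- exact: square_integrableZ.
Qed.

(** The opposite of the initial value of [solution] below, as determined by the
    boundary conditions. *)
Definition solution_shift : 'cV[R]_n.+1 := E^-1 *: (P *m \col_j primitive (q j) L).

(** U^-1 u for the function u = [solution] below: a primitive of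
    U^-1 e_n eps f. *)
Definition solution_coef x : 'cV[R]_n.+1 :=
  (\col_j primitive (q j) x) - solution_shift.

(** The solution u of u' = A u + eps f e_n, almost everywhere, that satisfies
    the boundary conditions, given by variation of constants. *)
Definition solution x : 'cV[R]_n.+1 := U lam x *m solution_coef x.

Lemma solution_coefE x j :
  solution_coef x j 0 = primitive (q j) x - solution_shift j 0.
Proof. by rewrite [LHS]mxE [X in X + _]mxE [X in _ + X]mxE. Qed.

(** In the separated case the initial value lies in the range of N_L, and the
    condition at L follows from A adj(A) = det(A) I with A = B_R M N_L; the
    periodic condition follows from the same identity with A = M - I. *)
Lemma solution_bc : real_bc bc (solution 0) (solution L).
Proof.
rewrite /solution /solution_coef /solution_shift; have [-> _ _] := UP lam; rewrite mul1mx.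
rewrite (_ : (\col_j primitive (q j) 0) = 0); last first.
  by apply/colP => j; rewrite !mxE primitive0.
rewrite sub0r /P; move: E0; rewrite /E.
set F := \col_j primitive (q j) L; set M := U lam L.
rewrite /evans /evans_P -/M; case: bc bc_wf => [k BL BR NL|] /=.
  move=> [kn BL1 BR1 BLN NL0] eN0; split.
    apply/BLN; exists (- ((\det (BR *m M *m NL))^-1 *:
      (\adj (BR *m M *m NL) *m (BR *m M) *m F))).
    by rewrite mulmxN -scalemxAr !mulmxA.
  rewrite mulmxA mulmxBr -scalemxAr !mulmxA. rewrite mul_mx_adj.
  by rewrite mul_scalar_mx -!scalemxAl scalerA mulVf// scale1r subrr.
move=> _ eN0; set e := \det _ in eN0 *; set G := \adj _ *m M *m F.
have h : (M - 1%:M) *m G = e *: (M *m F).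
  transitivity (((M - 1%:M) *m \adj (M - 1%:M)) *m (M *m F)); first by rewrite !mulmxA.
  by rewrite mul_mx_adj mul_scalar_mx.
have {}h : M *m G = e *: (M *m F) + G.
  by rewrite -h mulmxBl mul1mx subrK.
by rewrite mulmxBr -scalemxAr h scalerDr scalerA mulVf// scale1r opprD addNKr.
Qed.

Lemma solution_coef_bounded : exists2 K : R, 0 <= K &
  forall x j, x \in `[0, L] -> `|solution_coef x j 0| <= K.
Proof.
have [K K0 KP] := @finite_common_bound R 'I_n.+1 R (fun x => x \in `[0, L])
  (fun j => primitive (q j))
  (fun j => ex_intro _ _ (primitive_bounded (forcing_integrable j))).
exists (K + \sum_j `|solution_shift j 0|); first by rewrite addr_ge0// sumr_ge0.
move=> x j xL; rewrite solution_coefE.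
apply: le_trans (ler_normB _ _) _; apply: lerD; first exact: KP.
by rewrite (bigD1 j)//= lerDl sumr_ge0.
Qed.

Lemma solution_abs_continuous i : abs_continuous 0 L (fun x => solution x i 0).
Proof.
have [K K0 KP] := solution_coef_bounded.
have [KU KU0 KUP] := U_bound `|lam|.
have [KL KL0 KLP] := fundamental_mx_lipschitz L0 eps1 A0_smooth UP lam.
rewrite (_ : (fun x => _) = (fun x => \sum_j U lam x i j * solution_coef x j 0)); last first.
  by apply/funext => x; rewrite mxE.
apply: abs_continuous_sum => j; apply: (@abs_continuousM _ _ _ _ _ (K + KU)).
- move=> x xD; have [h _] := KUP lam x i j (lexx _) xD; lra.
- by move=> x xD; have := KP x j xD; lra.
- apply: (@abs_continuous_lipschitz _ _ _ _ KL) => s t sD tD; exact: KLP.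
- rewrite (_ : (fun x => _) = (fun x => primitive (q j) x + - solution_shift j 0)); last first.
    by apply/funext => x; rewrite solution_coefE.
  apply: abs_continuousD; last exact: abs_continuous_cst.
  by apply: abs_continuous_primitive => //; exact: forcing_integrable.
Qed.

Lemma solution_derive :
  {ae mu, forall x, x \in `]0, L[ -> forall i,
    is_derive x (1 : R) (fun t => solution t i 0)
      ((A0 x *m solution x +
        (eps * (f x + lam * solution x ord0 0)) *: delta_mx ord_max 0) i 0)}.
Proof.
have : {ae mu, forall x, forall j, x \in `]0, L[ ->
    is_derive x (1 : R) (primitive (q j)) (q j x)}.
  by apply: ae_forall_fin => j; apply: primitive_derive => //; exact: forcing_integrable.
apply: ae_impl => x h xL i.
have dc j : is_derive x (1 : R) (fun t => solution_coef t j 0) (q j x).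
  rewrite (_ : (fun x => _) = (fun x => primitive (q j) x + - solution_shift j 0)); last first.
    by apply/funext => y; rewrite solution_coefE.
  have h0 : is_derive x (1 : R) (fun=> - solution_shift j 0) 0.
    exact: is_derive_cst.
  by refine (is_derive_eq (is_derive_addE (h j xL) h0) _); rewrite addr0.
have [_ _ dU] := UP lam.
rewrite (_ : (fun t => solution t i 0) =
    (fun t => \sum_j U lam t i j * solution_coef t j 0)); last first.
  by apply/funext => t; rewrite mxE.
refine (is_derive_eq (is_derive_sumE (fun j => is_derive_mulE (dU _ xL i j) (dc j))) _).
rewrite big_split/=.
have -> : \sum_j (coef_mx eps A0 x lam *m U lam x) i j * solution_coef x j 0 =
    (coef_mx eps A0 x lam *m solution x) i 0 by rewrite /solution mulmxA [RHS]mxE.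
have -> : \sum_j U lam x i j * q j x = (eps * f x) * (i == ord_max)%:R.
  rewrite /q; under eq_bigr do rewrite mulrA.
  rewrite -mulr_suml mulrC; congr (_ * _).
  transitivity ((U lam x *m invmx (U lam x)) i ord_max); first by rewrite mxE.
  by rewrite mulmxV ?U_unit ?open_in_itv// mxE.
rewrite coef_mx_mulmx; move: (solution x) => w.
rewrite !mxE eqxx andbT; ring.
Qed.

(** The Green function represents the first component of the solution. *)
Lemma green_formula x : x \in `[0, L] ->
  E * solution x 0 0 = \int[mu]_(s in D) (green L bc U x s lam * (eps * f s)).
Proof.
move=> xL.
pose r j s := (if s < x then 1 else 0) * q j s.
have ir j : mu.-integrable D (EFin \o r j).
  apply: le_integrable (forcing_integrable j) => //.
    apply/measurable_EFinP; apply: measurable_funM.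
      apply: measurable_fun_if => //.
      exact: measurable_fun_ltr.
    by apply/measurable_EFinP; case/integrableP: (forcing_integrable j).
  move=> s _; rewrite /= lee_fin /r; case: ifP => _; first by rewrite mul1r.
  by rewrite mul0r normr0.
have rE j : \int[mu]_(s in D) r j s = primitive (q j) x.
  transitivity (\int[mu]_(s in D) (q j \_ `[0, x[%classic) s).
    apply: eq_Rintegral => s; rewrite inE/= in_itv/= => /andP[s0 sL].
    rewrite /r patchE; case: ifPn => sx.
      by rewrite mul1r mem_set//= in_itv/= s0.
    by rewrite mul0r memNset//= in_itv/= (negbTE sx) andbF.
  have /andP[x0 xl] : 0 <= x <= L by move: xL; rewrite in_itv.
  have sub : (`[0, x[ `<=` D)%classic by move=> s /=; rewrite !in_itv/=; lra.
  rewrite -Rintegral_mkcondr setIidr// Rintegral_itv_bndo_bndc//.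
  exact: integrable_subitv (forcing_integrable j) _ sub.
transitivity (\int[mu]_(s in D)
    \sum_j U lam x 0 j * (E * r j s - \sum_k P j k * q k s)); last first.
  apply: eq_Rintegral => s _; rewrite greenE mulr_suml; apply: eq_bigr => j _.
  rewrite -mulrA mulrBl mulr_suml; congr (_ * (_ - _)).
    by rewrite /r /q -/E; case: ifP => _; ring.
  by apply: eq_bigr => k _; rewrite -mulrA.
have iP j : mu.-integrable D (EFin \o (fun s => \sum_k P j k * q k s)).
  apply: integrable_sumr => k; apply: integrable_mulr; exact: forcing_integrable.
have irP j : mu.-integrable D (EFin \o (fun s => E * r j s - \sum_k P j k * q k s)).
  rewrite (_ : (fun s => _) = (fun s => E * r j s + (-1) * \sum_k P j k * q k s)).
    by apply: integrable_addr; exact: integrable_mulr.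
  by apply/funext => s; rewrite mulN1r.
rewrite Rintegral_sum => [|j]; last exact: integrable_mulr.
rewrite [X in _ * X]mxE mulr_sumr; apply: eq_bigr => j _.
rewrite RintegralZl// RintegralB//; last exact: integrable_mulr.
rewrite RintegralZl// rE mulrCA; congr (_ * _).
rewrite Rintegral_sum => [|k]; last by apply: integrable_mulr; exact: forcing_integrable.
rewrite solution_coefE mulrBr; congr (_ - _).
rewrite [X in _ * X]mxE mulVKf// [LHS]mxE; apply: eq_bigr => k _.
rewrite RintegralZl//; last exact: forcing_integrable.
by rewrite mxE.
Qed.

End solution.

End green.

(** * The weight and the Hilbert-Schmidt bound *)

Section weight.
Context {R : realType} (n : nat) (L eps : R).
Variables (A0 : R -> 'M[R]_n.+1) (bc : boundary R n.+1).
Variable (U : R -> R -> 'M[R]_n.+1).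
Hypotheses (L0 : 0 < L) (eps1 : eps = 1 \/ eps = -1).
Hypothesis A0_smooth : forall i j, smooth_on 0 L (fun x => A0 x i j).
Hypothesis UP : fundamental_mx L eps A0 U.
Local Notation mu := (@lebesgue_measure R).
Local Notation D := (`[0, L]%classic : set R).
Local Notation green := (green L bc U).
Local Notation E := (evans L bc U).
Local Notation P := (evans_P L bc U).
Local Notation W := (weight L bc U).

(** A bound for the Green function that depends only on bounds for [lam], E
    and P, and is therefore locally uniform in [lam]. *)
Lemma green_bound (Lam p : R) : exists2 K : R, 0 <= K &
  forall lam, `|lam| <= Lam -> `|E lam| <= p -> (forall i j, `|P lam i j| <= p) ->
  forall x s, x \in `[0, L] -> s \in `[0, L] -> `|green x s lam| <= K.
Proof.
have [KU KU0 KUP] := fundamental_mx_bound L0 eps1 A0_smooth UP Lam.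
pose K := n.+1%:R * (KU * (`|p| * KU + n.+1%:R * (`|p| * KU))).
exists K.
  by rewrite /K !(mulr_ge0, addr_ge0).
move=> lam lamL Ep Pp x s xL sL; rewrite greenE.
have sum_bound (g : 'I_n.+1 -> R) c : (forall j, `|g j| <= c) -> `|\sum_j g j| <= n.+1%:R * c.
  move=> gc; apply: le_trans (ler_norm_sum _ _ _) _.
  by rewrite mulr_natl -[X in _ *+ X]card_ord -sumr_const; apply: ler_sum.
apply: (sum_bound) => j; rewrite normrM; apply: ler_pM => //.
  by have [] := KUP lam x 0 j lamL xL.
have hV k : `|invmx (U lam s) k ord_max| <= KU by have [] := KUP lam s k ord_max lamL sL.
have pp := ler_norm p.
apply: le_trans (ler_normB _ _) _; apply: lerD.
  rewrite normrM; apply: ler_pM => //; case: ifP => _; last by rewrite normr0.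
  exact: le_trans pp.
apply: (sum_bound) => k; rewrite normrM; apply: ler_pM => //.
exact: le_trans (Pp _ _) pp.
Qed.

Lemma green_bounded lam : exists2 K : R, 0 <= K &
  forall x s, x \in `[0, L] -> s \in `[0, L] -> `|green x s lam| <= K.
Proof.
pose p := `|E lam| + \sum_i \sum_j `|P lam i j|.
have [K K0 KP] := green_bound `|lam| p.
exists K => //; apply: KP => //.
  by rewrite /p lerDl; apply: sumr_ge0 => i _; apply: sumr_ge0.
move=> i j; rewrite /p (bigD1 i)//= (bigD1 j)//=.
have : 0 <= \sum_(j0 < n.+1 | j0 != j) `|P lam i j0| by exact: sumr_ge0.
have : 0 <= \sum_(i0 < n.+1 | i0 != i) \sum_j `|P lam i0 j|.
  by apply: sumr_ge0 => k _; exact: sumr_ge0.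
have := normr_ge0 (E lam); lra.
Qed.

Lemma green_measurable lam x : measurable_fun D (fun s => green x s lam).
Proof.
have mV := invmx_fundamental_measurable L0 eps1 A0_smooth UP lam.
rewrite (_ : (fun s => _) = (fun s => \sum_j U lam x 0 j *
  ((if s < x then E lam else 0) * invmx (U lam s) j ord_max
    - \sum_k P lam j k * invmx (U lam s) k ord_max))); last first.
  by apply/funext => s; rewrite greenE.
apply: measurable_sum => j; apply: measurable_funM => //.
apply: measurable_funB.
  apply: measurable_funM => //; apply: measurable_fun_if => //.
  exact: measurable_fun_ltr.
by apply: measurable_sum => k; exact: measurable_funM.
Qed.

Lemma green_square_integrable lam x : x \in `[0, L] ->
  square_integrable L (fun s => green x s lam).
Proof.
move=> xL; have [K _ KP] := green_bounded lam.
apply: (@square_integrable_bounded _ _ _ K); first exact: green_measurable.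
by move=> s sL; exact: KP.
Qed.

(** The inner integral in the square of the weight. *)
Definition green_sqr lam x := \int[mu]_(s in D) (green x s lam ^+ 2).

Lemma green_sqr_ge0 lam x : 0 <= green_sqr lam x.
Proof. by apply: Rintegral_ge0 => s _; exact: sqr_ge0. Qed.

Lemma green_sqr_le lam x K : x \in `[0, L] -> 0 <= K ->
  (forall s, s \in `[0, L] -> `|green x s lam| <= K) -> green_sqr lam x <= K ^+ 2 * L.
Proof.
move=> xL K0 gK.
have -> : K ^+ 2 * L = \int[mu]_(s in D) (K ^+ 2).
  rewrite Rintegral_cst//= lebesgue_measure_itv/= lte_fin L0/=.
  by rewrite subr0.
apply: le_Rintegral => //.
- by case: (green_square_integrable lam xL).
- exact: integrable_cst_itv.
- move=> s sL; rewrite -[X in X <= _]real_normK ?num_real//.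
  by rewrite lerXn2r ?nnegrE ?gK.
Qed.

(** Tonelli's theorem, applied to the Green function extended by zero outside
    the square. *)
Lemma green_sqr_measurable lam : measurable_fun D (green_sqr lam).
Proof.
have mU := fundamental_mx_measurable UP lam.
have mV := invmx_fundamental_measurable L0 eps1 A0_smooth UP lam.
pose Ut j : R -> R := (fun x => U lam x 0 j) \_ D.
pose Vt k : R -> R := (fun s => invmx (U lam s) k ord_max) \_ D.
have mUt j : measurable_fun setT (Ut j).
  by apply/measurable_restrict => //; rewrite setTI.
have mVt k : measurable_fun setT (Vt k).
  by apply/measurable_restrict => //; rewrite setTI.
pose G (p : measurableTypeR R * measurableTypeR R) : R :=
  \sum_j Ut j p.1 * ((if p.2 < p.1 then E lam else 0) * Vt j p.2
    - \sum_k P lam j k * Vt k p.2).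
have mG : measurable_fun setT G.
  apply: measurable_sum => j; apply: measurable_funM.
    by apply: measurableT_comp (mUt j) _; exact: measurable_fst.
  apply: measurable_funB.
    apply: measurable_funM.
      by apply: measurable_fun_ifT => //; apply: measurable_fun_ltr.
    by apply: measurableT_comp (mVt j) _; exact: measurable_snd.
  apply: measurable_sum => k; apply: measurable_funM => //.
  by apply: measurableT_comp (mVt k) _; exact: measurable_snd.
have mG2 : measurable_fun setT (fun p => (G p ^+ 2)%:E).
  by apply/measurable_EFinP; exact: measurable_funX.
have := @measurable_fun_fubini_tonelli_F _ _ _ _ R mu _ mG2
  (fun p => sqr_ge0 (G p)).
rewrite /fubini_F => mF.
have : measurable_fun D (fun x => fine (\int[mu]_y (G (x, y) ^+ 2)%:E)).
  by apply: measurable_funS (measurableT_comp (fine_measurable measurableT) mF).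
apply: eq_measurable_fun => x; rewrite inE => xL.
rewrite /green_sqr Rintegral_mkcond; congr fine; apply: eq_integral => s _.
rewrite /= patchE /G; case: (boolP (s \in D)) => sL /=.
  have Uj j : Ut j x = U lam x 0 j by rewrite /Ut patchE mem_set.
  have Vj k : Vt k s = invmx (U lam s) k ord_max by rewrite /Vt patchE sL.
  rewrite greenE; congr (_ ^+ 2)%:E; apply: eq_bigr => j _; rewrite Uj Vj.
  by congr (_ * (_ - _)); apply: eq_bigr => k _; rewrite Vj.
rewrite big1 ?expr0n// => j _; rewrite /Vt patchE (negbTE sL) mulr0 big1 ?subrr ?mulr0// => k _.
by rewrite patchE (negbTE sL) mulr0.
Qed.

Lemma green_sqr_integrable lam : mu.-integrable D (EFin \o green_sqr lam).
Proof.
have [K K0 KP] := green_bounded lam.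
apply: (@le_integrable_fin _ _ _ (fun=> K ^+ 2 * L)).
- exact: green_sqr_measurable.
- move=> x xL; rewrite ger0_norm ?green_sqr_ge0//; apply: green_sqr_le => // s sL.
  exact: KP.
- exact: integrable_cst_itv.
Qed.

Lemma weight_sqr lam : W lam ^+ 2 = \int[mu]_(x in D) green_sqr lam x.
Proof.
by rewrite sqr_sqrtr//; apply: Rintegral_ge0 => x _; exact: green_sqr_ge0.
Qed.

Lemma weight_ge0 lam : 0 <= W lam.
Proof. exact: sqrtr_ge0. Qed.

Lemma weight_le lam K : 0 <= K ->
  (forall x s, x \in `[0, L] -> s \in `[0, L] -> `|green x s lam| <= K) ->
  W lam <= K * L.
Proof.
move=> K0 gK; rewrite -ler_sqr ?nnegrE ?weight_ge0 ?mulr_ge0 ?(ltW L0)//.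
rewrite weight_sqr.
have -> : (K * L) ^+ 2 = \int[mu]_(s in D) (K ^+ 2 * L).
  rewrite Rintegral_cst//= lebesgue_measure_itv/= lte_fin L0/=.
  by rewrite subr0; ring.
apply: le_Rintegral => //.
- exact: green_sqr_integrable.
- exact: integrable_cst_itv.
- by move=> x xL; apply: green_sqr_le => // s sL; exact: gK.
Qed.

Lemma solution_square_integrable lam f i : square_integrable L f ->
  square_integrable L (fun x => solution L eps bc U lam f x i 0).
Proof.
move=> f2; set u := solution L eps bc U lam f.
have [K K0 KP] := solution_coef_bounded bc L0 eps1 A0_smooth UP lam f2.
have [KU KU0 KUP] := fundamental_mx_bound L0 eps1 A0_smooth UP `|lam|.
apply: (@square_integrable_bounded _ _ _ (n.+1%:R * (KU * K))); last first.
  move=> x xL; rewrite /u /solution mxE; apply: le_trans (ler_norm_sum _ _ _) _.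
  rewrite mulr_natl -[X in _ *+ X]card_ord -sumr_const; apply: ler_sum => j _.
  rewrite normrM; apply: ler_pM => //; last exact: KP.
  by have [] := KUP lam x i j (lexx _) xL.
rewrite (_ : (fun x => _) = (fun x => \sum_j U lam x i j *
    solution_coef L eps bc U lam f x j 0)); last first.
  by apply/funext => x; rewrite /u /solution mxE.
apply: measurable_sum => j; apply: measurable_funM.
  exact: (fundamental_mx_measurable UP).
rewrite (_ : (fun x => _) = (fun x =>
    primitive (fun s => invmx (U lam s) j ord_max * (eps * f s)) x
    - solution_shift L eps bc U lam f j 0)); last first.
  by apply/funext => x; exact: solution_coefE.
apply: measurable_funB => //.
apply: subspace_continuous_measurable_fun => //.
apply: parameterized_integral_continuous; first exact: ltW.
by apply: (forcing_integrable L0 eps1 A0_smooth UP).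
Qed.

(** The Hilbert-Schmidt bound for the resolvent: Cauchy-Schwarz in the inner
    variable, then integration in the outer one. *)
Lemma solution_bound lam f : square_integrable L f -> E lam != 0 ->
  E lam ^+ 2 * \int[mu]_(x in D) (solution L eps bc U lam f x 0 0 ^+ 2) <=
  W lam ^+ 2 * \int[mu]_(x in D) (f x ^+ 2).
Proof.
move=> f2 E0; set u := solution L eps bc U lam f.
have [_ u2] := solution_square_integrable lam 0 f2.
have if2 := f2.2.
rewrite weight_sqr -RintegralZl// -RintegralZr//; last exact: green_sqr_integrable.
apply: le_Rintegral => //.
- exact: integrable_mulr.
- rewrite (_ : (fun x => _) = (fun x => (\int[mu]_(x in D) (f x ^+ 2)) * green_sqr lam x)).
    by apply: integrable_mulr; exact: green_sqr_integrable.
  by apply/funext => x; rewrite mulrC.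
move=> x xL; rewrite -exprMn (green_formula L0 eps1 A0_smooth UP f2 E0 xL).
have ef2 := square_integrableZ eps f2.
apply: le_trans (cauchy_schwarz_itv (green_square_integrable lam xL) ef2) _.
apply: ler_wpM2l; first exact: green_sqr_ge0.
rewrite le_eqVlt; apply/orP; left; apply/eqP; apply: eq_Rintegral => s _.
by rewrite exprMn; case: eps1 => ->; rewrite ?sqrrN expr1n mul1r.
Qed.

End weight.

Local Open Scope complex_scope.

(** * Complex functions *)

Section complex_parts.
Context {R : realType}.
Implicit Types (x y : R[i]) (a : R).

Lemma CReD x y : complex.Re (x + y) = complex.Re x + complex.Re y.
Proof. by case: x; case: y. Qed.

Lemma CImD x y : complex.Im (x + y) = complex.Im x + complex.Im y.
Proof. by case: x; case: y. Qed.

Lemma CReB x y : complex.Re (x - y) = complex.Re x - complex.Re y.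
Proof. by case: x; case: y. Qed.

Lemma CImB x y : complex.Im (x - y) = complex.Im x - complex.Im y.
Proof. by case: x; case: y. Qed.

Lemma CReZ a x : complex.Re (a%:C * x) = a * complex.Re x.
Proof. by case: x => b c /=; rewrite mul0r subr0. Qed.

Lemma CImZ a x : complex.Im (a%:C * x) = a * complex.Im x.
Proof. by case: x => b c /=; rewrite mul0r addr0. Qed.

Lemma eq_complexP x y :
  complex.Re x = complex.Re y -> complex.Im x = complex.Im y -> x = y.
Proof. by case: x => a b; case: y => c d /= -> ->. Qed.

Lemma complex_affine (p q a v w : R) :
  (p +i* q) + a%:C * (v +i* w) = (p + a * v) +i* (q + a * w).
Proof. by apply: eq_complexP; rewrite ?CReD ?CImD ?CReZ ?CImZ. Qed.

Lemma CReMconj x y : complex.Re (x * y^*) =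
  complex.Re x * complex.Re y + complex.Im x * complex.Im y.
Proof. by case: x => a b; case: y => c d /=; rewrite mulrN opprK. Qed.

Lemma sqr_normc x : Normc.normc x ^+ 2 = complex.Re x ^+ 2 + complex.Im x ^+ 2.
Proof. by case: x => a b; rewrite sqr_sqrtr// addr_ge0 ?sqr_ge0. Qed.

(** The complex vector with given real and imaginary parts. *)
Definition complex_cV n (a b : 'cV[R]_n) : 'cV[R[i]]_n :=
  \col_i (a i 0 +i* b i 0).

Lemma mulmx_complex_cV m n (A : 'M[R]_(m, n)) (a b : 'cV[R]_n) :
  map_mx (real_complex R) A *m complex_cV a b = complex_cV (A *m a) (A *m b).
Proof.
apply/colP => i; rewrite !mxE.
have reS (F : 'I_n -> R[i]) : complex.Re (\sum_j F j) = \sum_j complex.Re (F j).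
  exact: (big_morph _ CReD erefl).
have imS (F : 'I_n -> R[i]) : complex.Im (\sum_j F j) = \sum_j complex.Im (F j).
  exact: (big_morph _ CImD erefl).
apply: eq_complexP; rewrite /= ?reS ?imS; apply: eq_bigr => j _; rewrite !mxE.
  by rewrite CReZ.
by rewrite CImZ.
Qed.

Lemma complex_cV0 n : complex_cV 0 0 = 0 :> 'cV[R[i]]_n.
Proof. by apply/colP => i; rewrite !mxE. Qed.

Lemma satisfies_bc_complex n (L : R) (bc : boundary R n) (a b : R -> 'cV[R]_n) :
  real_bc bc (a 0) (a L) -> real_bc bc (b 0) (b L) ->
  satisfies_bc L bc (fun t => complex_cV (a t) (b t)).
Proof.
case: bc => [k BL BR NL|] /=; last by move=> -> ->.
move=> [a0 aL] [b0 bL]; rewrite !mulmx_complex_cV a0 aL b0 bL.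
by rewrite !complex_cV0.
Qed.

End complex_parts.

Section L2.
Context {R : realType} (L : R).
Local Notation mu := (@lebesgue_measure R).
Local Notation D := (`[0, L]%classic : set R).
Implicit Types f g : R -> R[i].

(** A complex function is in L_2 exactly when its real and imaginary parts
    are. *)
Lemma L2P f : L2 L f <-> square_integrable L (fun x => complex.Re (f x)) /\
  square_integrable L (fun x => complex.Im (f x)).
Proof.
have E : (fun t => (Normc.normc (f t) ^+ 2)%:E) =
    EFin \o (fun t => complex.Re (f t) ^+ 2 + complex.Im (f t) ^+ 2).
  by apply/funext => t /=; rewrite sqr_normc.
split=> [[mr mi]|[[mr ir] [mi ii]]]; last first.
  by split=> //; rewrite E; exact: integrable_addr.
rewrite E => ni; split; split => //; apply: le_integrable_fin ni.
- exact: measurable_funX.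
- by move=> x _; rewrite ger0_norm ?sqr_ge0// lerDl sqr_ge0.
- exact: measurable_funX.
- by move=> x _; rewrite ger0_norm ?sqr_ge0// lerDr sqr_ge0.
Qed.

Lemma L2D f g : L2 L f -> L2 L g -> L2 L (fun x => f x + g x).
Proof.
move=> /L2P[fr fi] /L2P[gr gi]; apply/L2P; split.
  by apply: eq_square_integrable (square_integrableD fr gr) => x _; rewrite CReD.
by apply: eq_square_integrable (square_integrableD fi gi) => x _; rewrite CImD.
Qed.

Lemma L2B f g : L2 L f -> L2 L g -> L2 L (fun x => f x - g x).
Proof.
move=> /L2P[fr fi] /L2P[gr gi]; apply/L2P; split.
  by apply: eq_square_integrable (square_integrableB fr gr) => x _; rewrite CReB.
by apply: eq_square_integrable (square_integrableB fi gi) => x _; rewrite CImB.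
Qed.

Lemma L2Z (a : R) f : L2 L f -> L2 L (fun x => a%:C * f x).
Proof.
move=> /L2P[fr fi]; apply/L2P; split.
  by apply: eq_square_integrable (square_integrableZ a fr) => x _; rewrite CReZ.
by apply: eq_square_integrable (square_integrableZ a fi) => x _; rewrite CImZ.
Qed.

Lemma L2norm_sqr f : L2 L f -> L2norm L f ^+ 2 =
  \int[mu]_(x in D) (complex.Re (f x) ^+ 2) + \int[mu]_(x in D) (complex.Im (f x) ^+ 2).
Proof.
move=> /L2P[[_ fr] [_ fi]]; rewrite sqr_sqrtr.
  by rewrite -RintegralD//; apply: eq_Rintegral => x _; rewrite sqr_normc.
by apply: Rintegral_ge0 => x _; exact: sqr_ge0.
Qed.

(** The real part of the pointwise Hermitian product of [f] and [g]. *)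
Definition redot f g x : R :=
  complex.Re (f x) * complex.Re (g x) + complex.Im (f x) * complex.Im (g x).

Lemma integrable_redot f g : L2 L f -> L2 L g -> mu.-integrable D (EFin \o redot f g).
Proof.
move=> /L2P[fr fi] /L2P[gr gi].
by apply: integrable_addr; exact: square_integrable_mul.
Qed.

Lemma Re_L2inner f g : complex.Re (L2inner L f g) = \int[mu]_(x in D) redot f g x.
Proof. by rewrite /=; apply: eq_Rintegral => x _; rewrite CReMconj. Qed.

Lemma ae_equal_of_norm0 f g : L2 L f -> L2 L g ->
  \int[mu]_(x in D) redot (fun x => f x - g x) (fun x => f x - g x) x = 0 ->
  ae_equal L f g.
Proof.
move=> f2 g2; have /L2P[[mr ir] [mi ii]] := L2B f2 g2.
set w := fun x => f x - g x.
have -> : \int[mu]_(x in D) redot w w x =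
    \int[mu]_(x in D) (complex.Re (w x) ^+ 2) + \int[mu]_(x in D) (complex.Im (w x) ^+ 2).
  by rewrite -RintegralD.
have r0 : 0 <= \int[mu]_(x in D) (complex.Re (w x) ^+ 2).
  by apply: Rintegral_ge0 => x _; exact: sqr_ge0.
have i0 : 0 <= \int[mu]_(x in D) (complex.Im (w x) ^+ 2).
  by apply: Rintegral_ge0 => x _; exact: sqr_ge0.
move/eqP; rewrite paddr_eq0// => /andP[/eqP wr /eqP wi].
have aer := Rintegral_sqr_eq0 (conj mr ir) wr.
have aei := Rintegral_sqr_eq0 (conj mi ii) wi.
apply: ae_impl (ae_conj aer aei) => x [hr hi] xD; apply/eqP; rewrite -subr_eq0.
by apply/eqP/eq_complexP; [exact: hr|exact: hi].
Qed.

End L2.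

(** * The real spectrum and the zeros of the Evans function *)

Section resolvent.
Context {R : realType} (n : nat) (L eps : R).
Variables (A0 : R -> 'M[R]_n.+1) (bc : boundary R n.+1).
Variable (U : R -> R -> 'M[R]_n.+1).
Hypotheses (L0 : 0 < L) (eps1 : eps = 1 \/ eps = -1).
Hypothesis A0_smooth : forall i j, smooth_on 0 L (fun x => A0 x i j).
Hypothesis bc_wf : boundary_wf bc.
Hypothesis det1 : determined_by_first L eps A0 bc.
Local Notation T := (ode_operator L eps A0 bc).
Hypothesis T_sa : self_adjoint L T.
Hypothesis UP : fundamental_mx L eps A0 U.
Local Notation mu := (@lebesgue_measure R).
Local Notation D := (`[0, L]%classic : set R).
Local Notation E := (evans L bc U).
Local Notation W := (weight L bc U).

(** The coefficients being real, real and imaginary parts of a solution of the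
    complex boundary value problem may be prescribed separately. *)
Lemma bvp_solution_complex (a b : R -> 'cV[R]_n.+1) (gr gi : R -> R) :
  (forall i, abs_continuous 0 L (fun x => a x i 0)) ->
  (forall i, abs_continuous 0 L (fun x => b x i 0)) ->
  {ae mu, forall x, x \in `]0, L[ -> forall i, is_derive x (1 : R) (fun t => a t i 0)
     ((A0 x *m a x + (eps * gr x) *: delta_mx ord_max 0) i 0)} ->
  {ae mu, forall x, x \in `]0, L[ -> forall i, is_derive x (1 : R) (fun t => b t i 0)
     ((A0 x *m b x + (eps * gi x) *: delta_mx ord_max 0) i 0)} ->
  real_bc bc (a 0) (a L) -> real_bc bc (b 0) (b L) ->
  bvp_solution L eps A0 bc (fun x => complex_cV (a x) (b x)) (fun x => gr x +i* gi x).
Proof.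
move=> aca acb da db bca bcb.
have reE i : (fun x => complex.Re (complex_cV (a x) (b x) i 0)) = (fun x => a x i 0).
  by apply/funext => x; rewrite mxE.
have imE i : (fun x => complex.Im (complex_cV (a x) (b x) i 0)) = (fun x => b x i 0).
  by apply/funext => x; rewrite mxE.
split.
- by move=> i; split; rewrite ?reE ?imE.
- apply: ae_impl (ae_conj da db) => x [ha hb] xL i.
  rewrite /is_cderive reE imE mulmx_complex_cV.
  rewrite [X in complex.Re X]mxE [X in complex.Im X]mxE CReD CImD.
  rewrite [X in complex.Re X + _]mxE [X in complex.Im X + _]mxE /=.
  rewrite [X in _ + complex.Re X]mxE [X in _ + complex.Im X]mxE.
  split.
    apply: is_derive_eq (ha xL i) _; rewrite [LHS]mxE; congr (_ + _).
    rewrite !mxE; case: (_ && _); rewrite ?mulr1 ?mulr0//.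
    by rewrite CReZ.
  apply: is_derive_eq (hb xL i) _; rewrite [LHS]mxE; congr (_ + _).
  rewrite !mxE; case: (_ && _); rewrite ?mulr1 ?mulr0//.
  by rewrite CImZ.
- exact: satisfies_bc_complex.
Qed.

(** The first component of the solution of (L - lam) y = f given by variation
    of constants, for a complex [f]. *)
Definition green_solution lam (f : R -> R[i]) (x : R) : R[i] :=
  solution L eps bc U lam (fun t => complex.Re (f t)) x 0 0 +i*
  solution L eps bc U lam (fun t => complex.Im (f t)) x 0 0.

Lemma green_solutionP lam f : E lam != 0 -> L2 L f ->
  shift_graph T lam%:C (green_solution lam f) f.
Proof.
move=> E0 f2; have /L2P[fr fi] := f2.
have y2 : L2 L (green_solution lam f).
  by apply/L2P; split; apply: solution_square_integrable.
split => //; first by apply: L2D => //; exact: L2Z.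
pose a := solution L eps bc U lam (fun t => complex.Re (f t)).
pose b := solution L eps bc U lam (fun t => complex.Im (f t)).
exists (fun x => complex_cV (a x) (b x)); last first.
  by apply: aeW => x _; rewrite mxE.
rewrite (_ : (fun x => f x + lam%:C * green_solution lam f x) =
  (fun x => (complex.Re (f x) + lam * a x ord0 0) +i*
            (complex.Im (f x) + lam * b x ord0 0))).
  apply: bvp_solution_complex.
  - by move=> i; apply: solution_abs_continuous.
  - by move=> i; apply: solution_abs_continuous.
  - exact: solution_derive.
  - exact: solution_derive.
  - exact: solution_bc.
  - exact: solution_bc.
apply/funext => x; rewrite /green_solution -/a -/b.
by move: (a x ord0 0) (b x ord0 0) => v w; case: (f x) => p q; exact: complex_affine.
Qed.

Lemma shift_graphI z y f g : (forall x, f x + z * y x = g x) ->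
  T y g -> shift_graph T z y f.
Proof. by move=> fg; rewrite /shift_graph (funext fg). Qed.

Lemma shift_graph_L2 z y f : shift_graph T z y f -> L2 L y.
Proof. by case. Qed.

(** For a real [lam] the difference w of two solutions is orthogonal to the
    range of L - lam; solving (L - lam) y = w shows that w is orthogonal to
    itself. *)
Lemma shift_graph_unique lam f y1 y2 : E lam != 0 -> L2 L f ->
  shift_graph T lam%:C y1 f -> shift_graph T lam%:C y2 f -> ae_equal L y1 y2.
Proof.
move=> E0 f2 Ty1 Ty2.
have y12 := shift_graph_L2 Ty1; have y22 := shift_graph_L2 Ty2.
pose w x := y1 x - y2 x.
have w2 : L2 L w by exact: L2B.
pose y := green_solution lam w.
have Ty : T y (fun x => w x + lam%:C * y x) := green_solutionP E0 w2.
have yL2 : L2 L y by case: Ty.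
have [_ sa] := T_sa.
have [_ _ /(_ _ _ Ty) adj1] := (sa _ _).1 Ty1.
have [_ _ /(_ _ _ Ty) adj2] := (sa _ _).1 Ty2.
have := congr1 (@complex.Re R) adj1; have := congr1 (@complex.Re R) adj2.
rewrite !Re_L2inner.
set g := fun x => w x + lam%:C * y x.
have g2 : L2 L g by apply: L2D => //; exact: L2Z.
have h12 : L2 L (fun x => f x + lam%:C * y1 x) by apply: L2D => //; exact: L2Z.
have h22 : L2 L (fun x => f x + lam%:C * y2 x) by apply: L2D => //; exact: L2Z.
move=> e2 e1; apply: ae_equal_of_norm0 => //.
(* |w|^2 is the difference of the adjoint identities for y1 and y2 *)
transitivity ((\int[mu]_(x in D) redot g y1 x -
    \int[mu]_(x in D) redot y (fun x => f x + lam%:C * y1 x) x)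
  - (\int[mu]_(x in D) redot g y2 x -
    \int[mu]_(x in D) redot y (fun x => f x + lam%:C * y2 x) x)); last first.
  by rewrite e1 e2 !subrr.
have i1 := integrable_redot g2 y12; have i2 := integrable_redot g2 y22.
have i3 := integrable_redot yL2 h12; have i4 := integrable_redot yL2 h22.
have iB (p q : R -> R) : mu.-integrable D (EFin \o p) -> mu.-integrable D (EFin \o q) ->
    mu.-integrable D (EFin \o (fun x => p x - q x)).
  move=> ip iq; apply: eq_integrable (integrableB _ ip iq) => //.
rewrite -!RintegralB//; [|exact: iB|exact: iB].
apply: eq_Rintegral => x _; rewrite /redot /g /w.
move: (f x) (y x) (y1 x) (y2 x) => [f1 f2'] [a b] [a1 b1] [a2 b2] /=; ring.
Qed.

(** The resolvent is bounded by W / |E|. *)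
Lemma evans_neq0_resolvent lam : E lam != 0 -> resolvent_set L T lam%:C.
Proof.
move=> E0; split.
- by move=> f f2; exists (green_solution lam f); exact: green_solutionP.
- by move=> f y1 y2; exact: shift_graph_unique.
exists (W lam / `|E lam|) => f y f2 Ty.
have y2 := shift_graph_L2 Ty.
have Tg := green_solutionP E0 f2; have g2 := shift_graph_L2 Tg.
have yg := shift_graph_unique E0 f2 Ty Tg.
have K0 : 0 <= W lam / `|E lam| by rewrite divr_ge0 ?weight_ge0.
rewrite -ler_sqr ?nnegrE ?mulr_ge0 ?sqrtr_ge0//.
rewrite exprMn !L2norm_sqr//.
have /L2P[yr yi] := y2; have /L2P[gr gi] := g2; have /L2P[fr fi] := f2.
rewrite (ae_Rintegral_sqr_eq yr gr); last by apply: ae_impl yg => x h /h ->.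
rewrite (ae_Rintegral_sqr_eq yi gi); last by apply: ae_impl yg => x h /h ->.
rewrite expr_div_n real_normK ?num_real// mulrAC ler_pdivlMr; last first.
  by rewrite exprn_even_gt0.
rewrite mulrC !mulrDr; apply: lerD.
  exact: (solution_bound L0 eps1 A0_smooth UP fr E0).
exact: (solution_bound L0 eps1 A0_smooth UP fi E0).
Qed.

(** A nonzero initial value whose solution of the homogeneous system satisfies
    the boundary conditions. *)
Lemma evans_eq0_vector lam : E lam = 0 ->
  exists2 c : 'cV[R]_n.+1, c != 0 & real_bc bc c (U lam L *m c).
Proof.
rewrite /evans; case: bc bc_wf => [k BL BR NL|] /=.
  move=> [_ _ _ BLN NL0]; rewrite -det_tr => /eqP/det0P[v vN0 v0].
  exists (NL *m v^T).
    apply: contra_neq vN0 => /NL0 h.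
    by rewrite -[v]trmxK h trmx0.
  split; first by apply/BLN; exists v^T.
  rewrite !mulmxA; apply: trmx_inj; rewrite trmx_mul trmxK trmx0.
  by rewrite v0.
move=> _; rewrite -det_tr => /eqP/det0P[v vN0 v0].
exists v^T; first by apply: contra_neq vN0 => h; rewrite -[v]trmxK h trmx0.
have : (U lam L - 1%:M) *m v^T = 0.
  by apply: trmx_inj; rewrite trmx_mul trmxK trmx0.
by rewrite mulmxBl mul1mx => /eqP; rewrite subr_eq0 => /eqP.
Qed.

Lemma bvp_solution0 : bvp_solution L eps A0 bc (fun=> 0) (fun=> 0).
Proof.
have ac0 : forall i : 'I_n.+1, abs_continuous 0 L (fun x : R => (0 : 'cV[R]_n.+1) i 0).
  by move=> i; exact: abs_continuous_cst.
have d0 : {ae mu, forall x, x \in `]0, L[ -> forall i,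
    is_derive x (1 : R) (fun t : R => (0 : 'cV[R]_n.+1) i 0)
     ((A0 x *m (0 : 'cV[R]_n.+1) + (eps * 0) *: delta_mx ord_max 0) i 0)}.
  apply: aeW => x _ i; rewrite mulmx0 add0r mulr0 scale0r mxE.
  exact: is_derive_cst.
have bc0 : real_bc bc (0 : 'cV[R]_n.+1) (0 : 'cV[R]_n.+1).
  by case: bc => [k BL BR NL|] //=; rewrite !mulmx0.
have := bvp_solution_complex (a := fun=> 0) (b := fun=> 0) (gr := fun=> 0)
  (gi := fun=> 0) ac0 ac0 d0 d0 bc0 bc0.
by rewrite (_ : (fun x : R => complex_cV 0 0) = fun=> 0)//; apply/funext => x; exact: complex_cV0.
Qed.

Lemma ode_operator0 : T (fun=> 0) (fun=> 0).
Proof.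
have s0 := square_integrable0 L.
split; [exact/L2P|exact/L2P|].
by exists (fun=> 0); [exact: bvp_solution0|apply: aeW => x _; rewrite mxE].
Qed.

(** A zero of the Evans function gives a real eigenfunction y.  It does not
    vanish in L_2: otherwise the first component of u, being continuous,
    would vanish identically, and so would u, which is determined by it. *)
Lemma evans_eq0_eigenfunction lam : E lam = 0 -> exists y : R -> R,
  [/\ square_integrable L y, \int[mu]_(x in D) (y x ^+ 2) != 0 &
      T (fun x => (y x)%:C) (fun x => (lam * y x)%:C)].
Proof.
move=> E0; have [c c0 cbc] := evans_eq0_vector E0.
have [U0 cU dU] := UP lam.
pose u x := U lam x *m c; pose y x : R := u x ord0 0.
have cy i : {within D, continuous (fun x => u x i 0)}.
  exact: (fundamental_mx_mulmx_continuous UP).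
have y2 : square_integrable L y.
  have [K KP] := continuous_itv_bounded (cy ord0).
  apply: (square_integrable_bounded (K := K)) => //.
  by apply: subspace_continuous_measurable_fun => //; exact: cy.
have bvp : bvp_solution L eps A0 bc (fun x => complex_cV (u x) 0) (fun x => (lam * y x) +i* 0).
  apply: (@bvp_solution_complex u (fun=> 0)).
  - move=> i; have [K K0 KP] := fundamental_mx_lipschitz L0 eps1 A0_smooth UP lam.
    rewrite (_ : (fun x => _) = (fun x => \sum_j U lam x i j * c j 0)); last first.
      by apply/funext => x; rewrite /u mxE.
    apply: abs_continuous_sum => j.
    apply: (@abs_continuous_lipschitz _ _ _ _ (K * `|c j 0|)) => s t sD tD.
    by rewrite -mulrBl normrM mulrAC; apply: ler_wpM2r => //; exact: KP.
  - move=> i; rewrite (_ : (fun x => _) = (fun=> 0)); first exact: abs_continuous_cst.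
    by apply/funext => x; rewrite mxE.
  - apply: aeW => x xL i.
    refine (is_derive_eq (fundamental_mx_mulmx UP lam c i 0 xL) _).
    by rewrite coef_mx_mulmx.
  - apply: aeW => x xL i; rewrite mulmx0 add0r mulr0 scale0r.
    rewrite (_ : (fun x => _) = (fun=> 0)); last by apply/funext => t; rewrite mxE.
    by rewrite mxE; exact: is_derive_cst.
  - by rewrite /u U0 mul1mx.
  - by case: bc => [k BL BR NL|] //=; rewrite !mulmx0.
exists y; split => //; last first.
  have s0 := square_integrable0 L.
  split.
  - by apply/L2P; split.
  - by apply/L2P; split => //; exact: square_integrableZ.
  - exists (fun x => complex_cV (u x) 0) => //.
    by apply: aeW => x _; rewrite [RHS]mxE [X in _ = Complex _ X]mxE.
apply/eqP => yint0; move/eqP: c0; apply.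
have y0 := continuous_ae_eq0 L0 (cy ord0) (Rintegral_sqr_eq0 y2 yint0).
have l2 : L2 L (fun x => (lam * y x) +i* 0).
  by apply/L2P; split; [exact: square_integrableZ|exact: square_integrable0].
have l0 : L2 L (fun=> 0) by case: ode_operator0.
have h := det1 l2 l0 bvp bvp_solution0.
have first0 x : x \in `[0, L] ->
    complex_cV (u x) 0 ord0 0 = (0 : 'cV[R[i]]_n.+1) ord0 0.
  move=> xL; rewrite [LHS]mxE [X in Complex _ X]mxE [RHS]mxE.
  by have := y0 x xL; rewrite /y => ->.
have := h first0 0 (zero_in_itv L0).
move/colP => h0; apply/colP => i; have := h0 i; rewrite /u U0 mul1mx !mxE.
by move=> /(congr1 (@complex.Re R)).
Qed.

Lemma resolvent_evans_neq0 lam : resolvent_set L T lam%:C -> E lam != 0.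
Proof.
move=> [_ uniq _]; apply/eqP => /evans_eq0_eigenfunction[y [y2 yN0 Ty]].
move/eqP: yN0; apply.
have T0 := ode_operator0; have [l0 _ _] := T0.
have : ae_equal L (fun x => (y x)%:C) (fun=> 0).
  apply: (uniq (fun=> 0) _ _ l0).
    by apply: shift_graphI Ty => x; rewrite add0r rmorphM.
  by apply: shift_graphI T0 => x; rewrite add0r mulr0.
have s0 := square_integrable0 L.
move=> ae0; rewrite (ae_Rintegral_sqr_eq y2 s0).
  by under eq_Rintegral do rewrite expr0n/=; rewrite Rintegral_cst// mul0r.
by apply: ae_impl ae0 => x h /h [].
Qed.

(** The distance from a regular point to an eigenvalue is at least |E| / W. *)
Lemma evans_weight_bound lam1 lam : E lam1 = 0 -> E lam != 0 ->
  0 < W lam /\ `|E lam| / W lam <= `|lam1 - lam|.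
Proof.
move=> E10 E0.
have [y [y2 yN0 Ty]] := evans_eq0_eigenfunction E10.
have f2 := square_integrableZ (lam1 - lam) y2.
pose f x : R[i] := ((lam1 - lam) * y x)%:C.
have fL2 : L2 L f.
  by apply/L2P; split => //; exact: square_integrable0.
have Tyf : shift_graph T lam%:C (fun x => (y x)%:C) f.
  apply: shift_graphI Ty => x; rewrite /f -rmorphM -rmorphD.
  by congr (_%:C); ring.
have yg := shift_graph_unique E0 fL2 Tyf (green_solutionP E0 fL2).
have := solution_bound L0 eps1 A0_smooth UP f2 E0.
have s2 : square_integrable L
    (fun x => solution L eps bc U lam (fun t => (lam1 - lam) * y t) x 0 0).
  exact: solution_square_integrable.
rewrite -(ae_Rintegral_sqr_eq y2 s2); last by apply: ae_impl yg => x h /h [].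
under [X in _ <= _ * X]eq_Rintegral do rewrite exprMn.
rewrite RintegralZl//; last by case: y2.
set I := \int[mu]_(x in D) (y x ^+ 2).
have I0 : 0 < I.
  by rewrite lt_def yN0; apply: Rintegral_ge0 => x _; exact: sqr_ge0.
rewrite mulrA ler_pM2r// -exprMn.
rewrite -(@real_normK _ (E lam)) ?num_real// -(@real_normK _ (W lam * _)) ?num_real//.
rewrite ler_sqr ?nnegrE// normrM (ger0_norm (weight_ge0 _ _ _ _)) => h.
have W0 : 0 < W lam.
  rewrite lt_def weight_ge0 andbT; apply: contra_neq E0 => W0.
  by apply/eqP; rewrite -normr_le0 (le_trans h)// W0 mul0r.
by split => //; rewrite ler_pdivrMr// mulrC.
Qed.

End resolvent.

(** * Monotone iteration *)

(** The iteration x -> x + E(x) / W(x) increases to the first zero of E after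
    the starting point, provided that no step can pass this zero and that [W]
    is locally bounded. *)
Lemma quotient_iteration_cvg (R : realType) (E W : R -> R) (l0 lp : R) (s : nat -> R) :
  l0 < lp -> E lp = 0 ->
  (forall x, l0 <= x -> x < lp -> [/\ 0 < E x, 0 < W x & E x / W x <= lp - x]) ->
  continuous E ->
  (forall x : R, exists K : R, \forall t \near x, W t <= K) ->
  s 0%N = l0 -> (forall i, s i.+1 = s i + E (s i) / W (s i)) ->
  s i @[i --> \oo] --> lp.
Proof.
move=> l0p Ep EW cE bW s0 sS.
have inv i : l0 <= s i /\ s i <= lp.
  elim: i => [|i [h1 h2]]; first by rewrite s0 lexx ltW.
  rewrite sS; have [lt|ge] := ltP (s i) lp.
    have [E0 W0 EWl] := EW _ h1 lt.
    have : 0 < E (s i) / W (s i) by exact: divr_gt0.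
    lra.
  have -> : s i = lp by apply/eqP; rewrite eq_le h2.
  by rewrite Ep mul0r addr0 lexx ltW.
have mono i : s i <= s i.+1.
  rewrite sS lerDl; have [h1 h2] := inv i.
  have [lt|ge] := ltP (s i) lp.
    by have [E0 W0 _] := EW _ h1 lt; rewrite ltW// divr_gt0.
  have -> : s i = lp by apply/eqP; rewrite eq_le h2.
  by rewrite Ep mul0r.
have ub : has_ubound (range s) by exists lp => _ [i _ <-]; have [] := inv i.
have /nondecreasing_seqP nd := mono.
have sl := nondecreasing_cvgn nd ub.
set l := sup (range s) in sl.
have sle i : s i <= l.
  by apply: ub_le_sup => //; exists i.
have l0l : l0 <= l by rewrite -s0.
have llp : l <= lp.
  by apply: ge_sup; [exists (s 0%N), 0%N|move=> _ [i _ <-]; have [] := inv i].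
have [lltp|] := ltP l lp; last first.
  by move=> lpl; have <- : l = lp by apply/eqP; rewrite eq_le llp.
exfalso.
have [El0 _ _] := EW _ l0l lltp.
have [K KP] := bW l.
have WK : \forall i \near \oo, W (s i) <= K by exact: (sl _ KP).
have Es : E (s i) @[i --> \oo] --> E l by apply: continuous_cvg => //; exact: cE.
have ds : `|K| * (s i.+1 - s i) @[i --> \oo] --> `|K| * (l - l).
  apply: cvgM; first exact: cvg_cst.
  by apply: cvgB => //; rewrite (cvg_shiftS s).
(* E(s_i) = W(s_i) (s_(i+1) - s_i) <= |K| (s_(i+1) - s_i), which tends to 0 *)
have : E l <= `|K| * (l - l).
  apply: (ler_cvg_to Es ds); apply: filterS WK => i Wi.
  have [h1 h2] := inv i; have lt : s i < lp by exact: le_lt_trans lltp.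
  have [E0 W0 _] := EW _ h1 lt.
  rewrite sS addrAC subrr add0r mulrA ler_pdivlMr// mulrC (ler_wpM2r (ltW E0))//.
  exact: le_trans Wi (ler_norm K).
by rewrite subrr mulr0 leNgt El0.
Qed.

Lemma quotient_iteration_cvg_decreasing (R : realType) (E W : R -> R) (l0 lm : R)
    (s : nat -> R) :
  lm < l0 -> E lm = 0 ->
  (forall x, lm < x -> x <= l0 -> [/\ 0 < E x, 0 < W x & E x / W x <= x - lm]) ->
  continuous E ->
  (forall x : R, exists K : R, \forall t \near x, W t <= K) ->
  s 0%N = l0 -> (forall i, s i.+1 = s i - E (s i) / W (s i)) ->
  s i @[i --> \oo] --> lm.
Proof.
move=> ml0 Em EW cE bW s0 sS.
have : - s i @[i --> \oo] --> - lm; last first.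
  by move/cvgN; under eq_cvg do rewrite opprK; rewrite opprK.
apply: (@quotient_iteration_cvg R (fun x => E (- x)) (fun x => W (- x)) (- l0)).
- by rewrite ltrN2.
- by rewrite opprK.
- move=> x l0x xm; have [||E0 W0 EWx] := EW (- x); [lra|lra|].
  by split; [exact: E0|exact: W0|lra].
- by move=> x; apply: continuous_comp; [exact: opp_continuous|exact: cE].
- move=> x; have [K KP] := bW (- x); exists K.
  have : - t @[t --> x] --> - x by apply: cvgN; exact: cvg_id.
  by move=> /(_ [set t | W t <= K]); apply; exact: KP.
- by rewrite s0.
- by move=> i; rewrite sS opprD !opprK.
Qed.

(** * Dependence on the spectral parameter *)

Section spectral_parameter.
Context {R : realType} (n : nat) (L eps : R).
Variables (A0 : R -> 'M[R]_n.+1) (bc : boundary R n.+1).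
Variable (U : R -> R -> 'M[R]_n.+1).
Hypotheses (L0 : 0 < L) (eps1 : eps = 1 \/ eps = -1).
Hypothesis A0_smooth : forall i j, smooth_on 0 L (fun x => A0 x i j).
Hypothesis UP : fundamental_mx L eps A0 U.
Local Notation E := (evans L bc U).
Local Notation P := (evans_P L bc U).
Local Notation W := (weight L bc U).

Lemma near_norm_le (a : R) : \forall t \near a, `|t| <= `|a| + 1.
Proof.
have : (fun t : R => `|t|) @ a --> `|a| by apply: cvg_norm; exact: cvg_id.
by move=> /cvgr_le; apply; rewrite ltrDl.
Qed.

Lemma monodromy_continuous lam i j : U t L i j @[t --> lam] --> U lam L i j.
Proof.
have [K K0 KP] := fundamental_mx_lipschitz_lam L0 eps1 A0_smooth UP (`|lam| + 1).
have c : K * `|t - lam| @[t --> lam] --> K * `|lam - lam|.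
  apply: cvgM; first exact: cvg_cst.
  by apply: cvg_norm; apply: cvgB; [exact: cvg_id|exact: cvg_cst].
rewrite subrr normr0 mulr0 in c.
apply/cvgrPdist_le => e e0.
move/cvgr_le : c => /(_ _ e0) near_c.
near=> t; rewrite distrC; apply: (@le_trans _ _ (K * `|t - lam|)).
  apply: KP; last exact: right_in_itv.
  - by rewrite lerDl.
  - by near: t; exact: near_norm_le.
by near: t; exact: near_c.
Unshelve. all: by end_near. Qed.

Lemma evans_continuous : continuous E.
Proof.
move=> lam; rewrite /continuous_at /evans; case: bc => [k BL BR NL|].
  apply: cvg_det; apply: cvg_mulmx; last by move=> *; exact: cvg_cst.
  apply: cvg_mulmx; first by move=> *; exact: cvg_cst.
  exact: monodromy_continuous.
apply: cvg_det => i j; rewrite [X in _ --> X]mxE; under eq_cvg do rewrite mxE.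
by apply: cvgD; [exact: monodromy_continuous|exact: cvg_cst].
Qed.

Lemma evans_P_continuous lam i j : P t i j @[t --> lam] --> P lam i j.
Proof.
move: i j; rewrite /evans_P; case: bc => [k BL BR NL|].
  have c : forall i j, (BR *m U t L) i j @[t --> lam] --> (BR *m U lam L) i j.
    apply: cvg_mulmx; first by move=> *; exact: cvg_cst.
    exact: monodromy_continuous.
  apply: cvg_mulmx => //; apply: cvg_mulmx; first by move=> *; exact: cvg_cst.
  by apply: cvg_adj; apply: cvg_mulmx => //; move=> *; exact: cvg_cst.
apply: cvg_mulmx; last exact: monodromy_continuous.
apply: cvg_adj => i j; rewrite [X in _ --> X]mxE; under eq_cvg do rewrite mxE.
by apply: cvgD; [exact: monodromy_continuous|exact: cvg_cst].
Qed.

Lemma weight_locally_bounded (lam : R) : exists K : R, \forall t \near lam, W t <= K.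
Proof.
pose p := `|E lam| + \sum_i \sum_j `|P lam i j| + 1.
have [K K0 KP] := green_bound bc L0 eps1 A0_smooth UP (`|lam| + 1) p.
exists (K * L).
have s0 : 0 <= \sum_i \sum_j `|P lam i j|.
  by apply: sumr_ge0 => i _; exact: sumr_ge0.
have Pp i j : `|P lam i j| < p.
  rewrite /p (bigD1 i)//= (bigD1 j)//=.
  have : 0 <= \sum_(j0 < n.+1 | j0 != j) `|P lam i j0| by exact: sumr_ge0.
  have : 0 <= \sum_(i0 < n.+1 | i0 != i) \sum_j `|P lam i0 j|.
    by apply: sumr_ge0 => k _; exact: sumr_ge0.
  have := normr_ge0 (E lam); lra.
have Ep : `|E lam| < p by rewrite /p -addrA ltrDl; lra.
have nE : \forall t \near lam, `|E t| <= p.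
  have cN : `|E t| @[t --> lam] --> `|E lam|.
    by apply: cvg_norm; exact: evans_continuous.
  by move/cvgr_le : cN; apply.
have nP : \forall t \near lam, forall i j, `|P t i j| <= p.
  apply: (@filter_forall R _ (fun i t => forall j, `|P t i j| <= p) _ (nbhs_filter lam)) => i.
  apply: (@filter_forall R _ (fun j t => `|P t i j| <= p) _ (nbhs_filter lam)) => j.
  have cN : `|P t i j| @[t --> lam] --> `|P lam i j|.
    by apply: cvg_norm; exact: evans_P_continuous.
  by move/cvgr_le : cN; apply.
near=> t; apply: (weight_le L0 eps1 A0_smooth UP) => //; apply: KP.
- by near: t; exact: near_norm_le.
- by near: t; exact: nE.
- by near: t; exact: nP.
Unshelve. all: by end_near. Qed.

End spectral_parameter.

(** * The limits of the two sequences *)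

Theorem theorem2p3 (R : realType) (n : nat) (L eps : R)
    (A0 : R -> 'M[R]_n.+1) (bc : boundary R n.+1)
    (U : R -> R -> 'M[R]_n.+1) (lambda0 : R) :
  0 < L ->
  eps = 1 \/ eps = -1 ->
  (forall i j, smooth_on 0 L (fun x => A0 x i j)) ->
  boundary_wf bc ->
  determined_by_first L eps A0 bc ->
  self_adjoint L (ode_operator L eps A0 bc) ->
  compact_resolvent L (ode_operator L eps A0 bc) ->
  fundamental_mx L eps A0 U ->
  resolvent_set L (ode_operator L eps A0 bc) lambda0%:C ->
  0 < evans L bc U lambda0 ->
  (forall lambdap : R,
     spectrum L (ode_operator L eps A0 bc) lambdap%:C -> lambda0 < lambdap ->
     (forall x : R, spectrum L (ode_operator L eps A0 bc) x%:C ->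
        lambda0 < x -> lambdap <= x) ->
     evans_seq L bc U 1 lambda0 i @[i --> \oo] --> lambdap) /\
  (forall lambdam : R,
     spectrum L (ode_operator L eps A0 bc) lambdam%:C -> lambdam < lambda0 ->
     (forall x : R, spectrum L (ode_operator L eps A0 bc) x%:C ->
        x < lambda0 -> x <= lambdam) ->
     evans_seq L bc U (-1) lambda0 i @[i --> \oo] --> lambdam).
Proof.
move=> L0 eps1 A0s bc_wf det1 T_sa _ UP _ E0.
set E := evans L bc U in E0 *; set W := weight L bc U.
have specE x : spectrum L (ode_operator L eps A0 bc) x%:C -> E x = 0.
  move=> sx; apply: contrapT => /eqP Ex; apply: sx.
  exact: (evans_neq0_resolvent L0 eps1 A0s bc_wf T_sa UP Ex).
have Espec x : E x = 0 -> spectrum L (ode_operator L eps A0 bc) x%:C.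
  move=> Ex /(resolvent_evans_neq0 L0 eps1 A0s bc_wf det1 UP).
  by rewrite -/E Ex eqxx.
have cE : continuous E by exact: (evans_continuous L0 eps1 A0s UP).
have bW := weight_locally_bounded bc L0 eps1 A0s UP.
(* By the intermediate value theorem, [E x] is positive when [E] has no zero
   between [lambda0] and [x]. *)
have Egt0 x : (forall c, Num.min lambda0 x <= c <= Num.max lambda0 x -> E c != 0) -> 0 < E x.
  move=> EN0; rewrite ltNge; apply/negP => Ex.
  have [lx|xl] := leP lambda0 x.
    have [|c cx Ec] := @IVT R E lambda0 x 0 lx (continuous_subspaceT cE).
      by rewrite ge_min le_max Ex (ltW E0) orbT.
    have := EN0 c; rewrite Ec eqxx => h; suff : false by []; apply: h.
    by move: cx; rewrite in_itv/= => /andP[c1 c2]; rewrite ge_min le_max c1 c2 orbT.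
  have [|c cx Ec] := @IVT R E x lambda0 0 (ltW xl) (continuous_subspaceT cE).
    by rewrite ge_min le_max Ex (ltW E0) orbT.
  have := EN0 c; rewrite Ec eqxx => h; suff : false by []; apply: h.
  by move: cx; rewrite in_itv/= => /andP[c1 c2]; rewrite ge_min le_max c1 c2 orbT.
split=> lp slp l0p lp_min.
- apply: (@quotient_iteration_cvg R E W lambda0).
  + exact: l0p.
  + exact: specE.
  + move=> x l0x xlp.
    have Ex : 0 < E x.
      apply: Egt0 => c cx; apply/eqP => /Espec sc.
      have c1 : lambda0 <= c <= x.
        by move: cx; rewrite (min_idPl _) // (max_idPr _).
      have [c2|c2] := ltP lambda0 c; first by have := lp_min _ sc c2; lra.
      have c3 : c = lambda0 by lra.
      by have := specE _ sc; rewrite c3; lra.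
    have [W0 EW] : 0 < W x /\ `|E x| / W x <= `|lp - x| :=
      evans_weight_bound L0 eps1 A0s bc_wf det1 T_sa UP (specE _ slp) (lt0r_neq0 Ex).
    split => //; move: EW; rewrite (gtr0_norm Ex) ger0_norm; lra.
  + exact: cE.
  + exact: bW.
  + by [].
  + by move=> i; rewrite [LHS]/= mul1r.
- apply: (@quotient_iteration_cvg_decreasing R E W lambda0).
  + exact: l0p.
  + exact: specE.
  + move=> x xlp l0x.
    have Ex : 0 < E x.
      apply: Egt0 => c cx; apply/eqP => /Espec sc.
      have c1 : x <= c <= lambda0.
        by move: cx; rewrite (min_idPr _) // (max_idPl _).
      have [c2|c2] := ltP c lambda0; first by have := lp_min _ sc c2; lra.
      have c3 : c = lambda0 by lra.
      by have := specE _ sc; rewrite c3; lra.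
    have [W0 EW] : 0 < W x /\ `|E x| / W x <= `|lp - x| :=
      evans_weight_bound L0 eps1 A0s bc_wf det1 T_sa UP (specE _ slp) (lt0r_neq0 Ex).
    split => //; move: EW; rewrite (gtr0_norm Ex) ler0_norm; lra.
  + exact: cE.
  + exact: bW.
  + by [].
  + by move=> i; rewrite [LHS]/= mulN1r.
Qed.
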